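(* Suppose that $a$ and $c$ are not both $0$, and let $\alpha<\beta$ be real numbers. Then $\sigma(J)=[\alpha,\beta]$ if and only if the following hold: (1) $a=\bar{c}$. (2) $\#\mathcal{S}=N-1$ and $P(\mathcal{S})\subset\{\pm2R\}$. (3) $P(\{\alpha,\beta\})\subset\{\pm2R\}$ and $\alpha,\beta\notin\mathcal{S}$. Here $R=|a|=|c|$.
   Context: Let $N\ge1$ and let $(a_n),(b_n),(c_n)$, $n\in\mathbb{Z}$, be $N$-periodic complex sequences. $J$ is the operator on $\ell^2(\mathbb{Z})$ given by $(Ju)_n=a_nu_{n+1}+b_nu_n+c_{n-1}u_{n-1}$, with spectrum $\sigma(J)$. Put $a=\prod_{i=1}^N a_i$, $c=\prod_{i=1}^N c_i$. For $\theta\in(-\pi,\pi]$ let $J(\theta)=J_0+J_1e^{i\theta}+J_{-1}e^{-i\theta}$, where $J_0$ is the $N\times N$ tridiagonal matrix with diagonal $b_1,\dots,b_N$, superdiagonal $a_1,\dots,a_{N-1}$, subdiagonal $c_1,\dots,c_{N-1}$; $J_1$ has the single possibly nonzero entry $c_N$ in position $(1,N)$; $J_{-1}$ has the single possibly nonzero entry $a_N$ in position $(N,1)$. Then $\det(\lambda\,\mathrm{Id}-J(\theta))=P(\lambda)-ae^{-i\theta}-ce^{i\theta}$, where $P$ is a monic polynomial of degree $N$ independent of $\theta$, called the discriminant of $J$. It is known that $\sigma(J)=P^{-1}(\{ae^{-i\theta}+ce^{i\theta}\mid\theta\in(-\pi,\pi]\})$. $\mathcal{S}=\{\lambda\in\mathbb{C}\mid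 P'(\lambda)=0\}$ is the set of stationary points of $P$, and $\#\mathcal{S}$ is its cardinality (points counted without multiplicity). *)

(* Defs.v *)
From HB Require Import structures.
From mathcomp Require Import all_boot all_order all_algebra.
From mathcomp Require Import complex.
From mathcomp Require Import all_classical all_reals all_analysis.
Set Implicit Arguments.
Unset Strict Implicit.
Unset Printing Implicit Defensive.
From mathcomp Require Import ring zify.
Import Order.TTheory GRing.Theory Num.Theory.
Local Open Scope ring_scope.
Local Open Scope classical_set_scope.
Local Open Scope complex_scope.

Section SequenceSpace.
Variable R : realType.
Implicit Types (u v : int -> R[i]) (T S : (int -> R[i]) -> (int -> R[i])).

Definition l2normsq u : \bar R :=
  \esum_(n in [set: int]) ((Normc.normc (u n)) ^+ 2)%:E.

Definition l2 : set (int -> R[i]) := [set u | (l2normsq u < +oo)%E].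

(* The norm of l^2(Z); `fine` makes it a real number, meaningful on `l2` only. *)
Definition l2norm u : R := Num.sqrt (fine (l2normsq u)).

(* Operators on l^2(Z) are maps on all sequences, of which only the
   restriction to `l2` matters. *)
Definition bounded_operator T :=
  [/\ (forall u, l2 u -> l2 (T u)),
      (forall (k : R[i]) u v, l2 u -> l2 v ->
         T (fun n => k * u n + v n) = (fun n => k * T u n + T v n)) &
      exists M : R, forall u, l2 u -> l2norm (T u) <= M * l2norm u].

Definition resolvent_set T : set R[i] :=
  [set z | exists S, bounded_operator S /\
     forall u, l2 u ->
       S (fun n => z * u n - T u n) = u /\
       (fun n => z * S u n - T (S u) n) = u].

Definition spectrum T : set R[i] := ~` resolvent_set T.

End SequenceSpace.

Lemma det_add_entry (F : comNzRingType) n (A : 'M[F]_n) (i0 j0 : 'I_n) (s : F) :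
  \det (A + s *: delta_mx i0 j0) = \det A + s * cofactor A i0 j0.
Proof.
rewrite (expand_det_row _ i0) (expand_det_row A i0).
have cE j : cofactor (A + s *: delta_mx i0 j0) i0 j = cofactor A i0 j.
  rewrite /cofactor; congr (_ * \det _); apply/matrixP => k l.
  by rewrite !mxE eq_sym (negbTE (neq_lift _ _)) mulr0 addr0.
under eq_bigr => j _ do rewrite cE !mxE eqxx /= mulrDl.
rewrite big_split /=; congr (_ + _); rewrite (bigD1 j0) //= eqxx mulr1.
by rewrite big1 ?addr0 // => j /negbTE ->; rewrite mulr0 mul0r.
Qed.

Section PeriodicJacobi.
Variable R : realType.
Implicit Types (a b c u : int -> R[i]) (N : nat) (t : R).

Definition jacobi a b c u : int -> R[i] :=
  fun n => a n * u (n + 1) + b n * u n + c (n - 1) * u (n - 1).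

Definition period_prod N a : R[i] := \prod_(1 <= i < N.+1) a i%:Z.

Definition expi t : R[i] := cos t +i* sin t.

(* Matrix indices start at 0 and sequence indices at 1, so that row i of the
   matrix corresponds to the index i.+1 of the sequences. *)
Definition jacobi0 N a b c : 'M[R[i]]_N :=
  \matrix_(i < N, j < N)
    if (i == j :> nat) then b i.+1%:Z
    else if (i.+1 == j :> nat) then a i.+1%:Z
    else if (i == j.+1 :> nat) then c j.+1%:Z
    else 0.

Definition jacobi1 N c : 'M[R[i]]_N :=
  \matrix_(i < N, j < N) if (i == 0%N :> nat) && (j.+1 == N) then c N%:Z else 0.

Definition jacobiN1 N a : 'M[R[i]]_N :=
  \matrix_(i < N, j < N) if (i.+1 == N) && (j == 0%N :> nat) then a N%:Z else 0.

Definition floquet N a b c t : 'M[R[i]]_N :=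
  jacobi0 N a b c + expi t *: jacobi1 N c + expi (- t) *: jacobiN1 N a.

(* The polynomial P such that
   det (z Id - floquet t) = P(z) - a exp(-it) - c exp(it),
   computed here from t = 0; see `discriminantE` for an arbitrary t. *)
Definition discriminant N a b c : {poly R[i]} :=
  char_poly (floquet N a b c 0) + (period_prod N a + period_prod N c)%:P.

Definition stationary_points (P : {poly R[i]}) : set R[i] :=
  [set z | P^`().[z] = 0].

Lemma det_floquet_aux N a b c (z : R[i]) : (0 < N)%N ->
  exists K, forall s w, s * w = 1 ->
    \det (z%:M - (jacobi0 N a b c + s *: jacobi1 N c + w *: jacobiN1 N a)) =
    K - period_prod N a * w - period_prod N c * s.
Proof.
case: N => [//|[_|n _]].
  exists (z - b 1) => s w _; rewrite det_mx11 !mxE /= /period_prod !big_nat1.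
  ring.
have sgn2 : (-1) ^+ n.+1 * (-1) ^+ n.+1 = 1 :> R[i].
  by rewrite -expr2 sqrr_sign.
pose M0 := z%:M - jacobi0 n.+2 a b c.
pose m := row' ord0 (col' ord_max M0).
pose d := cofactor m ord_max ord0.
exists (\det M0 + c n.+2%:Z * a n.+2%:Z * ((-1) ^+ n.+1 * d)) => s w sw.
have -> : z%:M - (jacobi0 n.+2 a b c + s *: jacobi1 n.+2 c
      + w *: jacobiN1 n.+2 a) =
    (M0 + (- (a n.+2%:Z * w)) *: delta_mx ord_max ord0) +
    (- (c n.+2%:Z * s)) *: delta_mx ord0 ord_max.
  apply/matrixP => i j; rewrite !mxE -!val_eqE /= !eqSS.
  set X := if i == j :> nat then _ else _; move: X => X.
  by case: (_ && _); case: (_ && _) => /=; ring.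
have aE : cofactor M0 ord_max ord0 = \prod_(1 <= i < n.+2) a i%:Z.
  rewrite /cofactor det_trig; last first.
    apply/is_trig_mxP => i j ij; rewrite !mxE -!val_eqE /= /bump /=.
    have -> : (n.+1 <= i)%N = false by have := ltn_ord i; rewrite /=; lia.
    rewrite add0n add1n.
    by move: ij => /= ij; do ?[case: ifP => [/eqP|_]; first by lia]; rewrite subr0.
  rewrite (eq_bigr (fun i : 'I_n.+1 => - a i.+1%:Z)) => [|i _]; last first.
    rewrite !mxE -!val_eqE /= /bump /=.
    have -> : (n.+1 <= i)%N = false by have := ltn_ord i; rewrite /=; lia.
    rewrite add0n add1n eqxx.
    have -> : (i == i.+1 :> nat) = false by lia.
    by rewrite ?mulr0n sub0r.
  by rewrite prodrN card_ord mulrA addn0 sgn2 mul1r big_add1 big_mkord.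
have mE : \det m = (-1) ^+ n.+1 * \prod_(1 <= i < n.+2) c i%:Z.
  rewrite -det_tr det_trig; last first.
    apply/is_trig_mxP => i j ij; rewrite !mxE -!val_eqE /= /bump /=.
    have -> : (n.+1 <= i)%N = false by have := ltn_ord i; rewrite /=; lia.
    rewrite add0n add1n.
    by move: ij => /= ij; do ?[case: ifP => [/eqP|_]; first by lia]; rewrite subr0.
  rewrite (eq_bigr (fun i : 'I_n.+1 => - c i.+1%:Z)) => [|i _]; last first.
    rewrite !mxE -!val_eqE /= /bump /=.
    have -> : (n.+1 <= i)%N = false by have := ltn_ord i; rewrite /=; lia.
    rewrite add0n add1n eqxx.
    have -> : (i.+1 == i :> nat) = false by lia.
    have -> : (i.+2 == i :> nat) = false by lia.
    by rewrite ?mulr0n sub0r.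
  by rewrite prodrN card_ord big_add1 big_mkord.
rewrite !det_add_entry aE /cofactor add0n.
have -> : row' ord0 (col' ord_max
      (M0 + (- (a n.+2%:Z * w)) *: delta_mx ord_max ord0)) =
    m + (- (a n.+2%:Z * w)) *: delta_mx ord_max ord0.
  apply/matrixP => i j; rewrite !mxE -!val_eqE /= /bump /=.
  by have := ltn_ord j; case: (ltngtP j n.+1) => //=; rewrite ?add1n ?add0n ?eqSS.
rewrite det_add_entry mE -/d /period_prod.
rewrite (big_nat_recr n.+2) //= [in RHS](big_nat_recr n.+2) //=.
ring: sgn2 sw.
Qed.

Lemma discriminantE N a b c t (z : R[i]) : (0 < N)%N ->
  \det (z%:M - floquet N a b c t) =
  (discriminant N a b c).[z] -
    period_prod N a * expi (- t) - period_prod N c * expi t.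
Proof.
move=> N0; rewrite /discriminant hornerD hornerC /char_poly.
have -> : (\det (char_poly_mx (floquet N a b c 0))).[z] =
          \det (z%:M - floquet N a b c 0).
  rewrite -[LHS]/(horner_eval z _) -det_map_mx; congr (\det _).
  apply/matrixP => i j; rewrite !mxE /= /horner_eval.
  by rewrite hornerD hornerN hornerC hornerMn hornerX.
pose M s w := z%:M - (jacobi0 N a b c + s *: jacobi1 N c + w *: jacobiN1 N a).
have E0 : expi 0 = 1 by rewrite /expi cos0 sin0.
have Ht : expi t * expi (- t) = 1.
  rewrite /expi cosN sinN; apply/eqP; rewrite eq_complex /=.
  by rewrite mulrN opprK -!expr2 cos2Dsin2 eqxx mulrN [sin t * _]mulrC addrC subrr eqxx.
have [K HK] : exists K, forall s w, s * w = 1 ->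
    \det (M s w) = K - period_prod N a * w - period_prod N c * s.
  exact: det_floquet_aux.
rewrite /floquet -/(M _ _) -/(M _ _) oppr0 E0 HK // HK ?mulr1 //.
ring.
Qed.

End PeriodicJacobi.

(* Main.v *)
(** The operator z - J is an N x N matrix over the ring of Laurent polynomials in the
    shift by N, with determinant P(z) - a T - c / T.  Multiplying by the adjugate, z - J is
    invertible on l^2(Z) as soon as this determinant has no zero on the unit circle, because
    each linear factor T - w with |w| <> 1 is inverted by a geometric series; a zero on the circle
    gives a bounded Floquet solution, whose truncations are approximate eigenvectors.  So the
    spectrum is the preimage under P of the ellipse { a / w + c w : |w| = 1 }.

    If that preimage is a real segment, then P(x) and its conjugate are two linear combinations
    of w and 1/w; eliminating, w and 1/w would be polynomials in x unless |a| = |c|, and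
    then a is the conjugate of c.  The ellipse is now [-2R, 2R], and all roots of P - t are
    real for t in this segment.  Laguerre's inequality P'^2 - (P - t) P'' > 0 at a stationary point
    for t = 2R and t = -2R shows that the value there is one of these and that P'' <> 0.
    Conversely, (2) and (3) give P^2 - 4R^2 = (x - alpha) (x - beta) (P'/N)^2.  The substitution
    x = m + h (w + 1/w) makes (x - alpha) (x - beta) a square, so that 4R^2 factors into two
    Laurent polynomials in w; they are monomials, hence P = +- R (w^n + w^-n), a rescaled
    Chebyshev polynomial. *)

Require Import Defs.
From mathcomp Require Import all_boot all_order all_algebra.
From mathcomp Require Import separable.
From mathcomp Require Import complex.
From mathcomp Require Import all_classical all_reals all_analysis.
From mathcomp Require Import ring lra zify.
Import Order.TTheory GRing.Theory Num.Theory.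
Local Open Scope ring_scope.
Local Open Scope complex_scope.
Import numFieldNormedType.Exports.

(** * Critical points of polynomials with real roots *)

(** Division-free form of [p'/p = sum of 1/(z - x)]: the conjugate of [p'] times [p] is |p|^2 times
    the conjugate of [p'/p], so each root contributes a nonnegative multiple of [z - x]. Here [r]
    and [r'] are the values of a product and of its derivative, and [w] is the factor being
    added. *)
Lemma Re_conj_step (R : rcfType) (e w r r' : R[i]) :
  complex.Re (e * (conjc (r + w * r') * (w * r))) =
  complex.Re (e * w) * (Normc.normc r ^+ 2) +
  Normc.normc w ^+ 2 * complex.Re (e * (conjc r' * r)).
Proof.
case: e w r r' => [e1 e2] [w1 w2] [r1 r2] [s1 s2] /=.
by rewrite !sqr_sqrtr ?addr_ge0 ?sqr_ge0 //; ring.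
Qed.

Lemma derivXsubC_mul (F : comNzRingType) (x : F) (p : {poly F}) :
  (('X - x%:P) * p)^`() = p + ('X - x%:P) * p^`().
Proof. by rewrite derivM derivXsubC mul1r. Qed.

Lemma hornerXsubC_mul (F : comNzRingType) (x z : F) (p : {poly F}) :
  (('X - x%:P) * p).[z] = (z - x) * p.[z].
Proof. by rewrite hornerM hornerXsubC. Qed.

Lemma normc_gt0 (R : rcfType) (z : R[i]) : z != 0 -> 0 < Normc.normc z.
Proof.
move=> z0; rewrite lt_neqAle; apply/andP; split.
  by apply: contra_neq z0 => /esym; exact: Normc.eq0_normc.
by case: z {z0} => ? ?; exact: sqrtr_ge0.
Qed.

(* Gauss-Lucas, for the half-plane [Re (e (z - x)) > 0]. *)
Lemma deriv_prod_XsubC_neq0 (R : rcfType) (e z : R[i]) (s : seq R[i]) :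
  s != [::] -> (forall x, x \in s -> 0 < complex.Re (e * (z - x))) ->
  (\prod_(x <- s) ('X - x%:P))^`().[z] != 0.
Proof.
move=> s0 Hs.
suff : 0 < complex.Re (e * (conjc (\prod_(x <- s) ('X - x%:P))^`().[z] *
                   (\prod_(x <- s) ('X - x%:P)).[z])).
  by apply: contraTneq => ->; rewrite conjc0 mul0r mulr0 ltxx.
(* One root [y] supplies strict positivity; the others only need [weak], whose induction starts from
   0 at the empty product. *)
case: s s0 Hs => [//|y s] _ Hs.
have step t : 0 <= complex.Re (e * (conjc (\prod_(x <- t) ('X - x%:P))^`().[z] *
                   (\prod_(x <- t) ('X - x%:P)).[z])) -> forall x,
   complex.Re (e * (z - x)) * Normc.normc (\prod_(x <- t) ('X - x%:P)).[z] ^+ 2 <= 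
   complex.Re (e * (conjc (\prod_(x <- x :: t) ('X - x%:P))^`().[z] *
                   (\prod_(x <- x :: t) ('X - x%:P)).[z])).
  move=> H x; rewrite big_cons derivXsubC_mul hornerD !hornerXsubC_mul.
  by rewrite Re_conj_step lerDl mulr_ge0 // sqr_ge0.
have weak : 0 <= complex.Re (e * (conjc (\prod_(x <- s) ('X - x%:P))^`().[z] *
                   (\prod_(x <- s) ('X - x%:P)).[z])).
  have {Hs} : forall x, x \in s -> 0 < complex.Re (e * (z - x)).
    by move=> x xs; apply: Hs; rewrite inE xs orbT.
  elim: s => [|x s IH] Hs.
    by rewrite big_nil derivC horner0 conjc0 mul0r mulr0.
  have /step/(_ x) : 0 <= complex.Re (e * (conjc (\prod_(x <- s) ('X - x%:P))^`().[z] *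
                   (\prod_(x <- s) ('X - x%:P)).[z])).
    by apply: IH => y' ys; apply: Hs; rewrite inE ys orbT.
  by apply: le_trans; rewrite mulr_ge0 ?sqr_ge0 // ltW // Hs ?mem_head.
apply: lt_le_trans (step _ weak y).
rewrite mulr_gt0 ?Hs ?mem_head // exprn_gt0 // normc_gt0 //.
rewrite horner_prod prodf_seq_neq0; apply/allP => x xs /=.
rewrite hornerXsubC; apply: contraTneq (Hs x _) => [->|]; last by rewrite inE xs orbT.
by rewrite mulr0 ltxx.
Qed.

(** The expression is [Q^2] times the sum of [1/(z - x)^2] over the roots; [step] is the
    division-free recursion behind this identity. *)
Lemma laguerre_prod_XsubC (F : numDomainType) (z : F) (s : seq F) :
  let Q := \prod_(x <- s) ('X - x%:P) in
  s != [::] -> z \is Num.real -> (forall x, x \in s -> x \is Num.real) -> Q.[z] != 0 ->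
  0 < Q^`().[z] ^+ 2 - Q.[z] * Q^`(2).[z].
Proof.
move=> /= s0 zr sr Qz.
have Qr t : (forall x, x \in t -> x \is Num.real) ->
    (\prod_(x <- t) ('X - x%:P)).[z] \is Num.real.
  move=> tr; rewrite horner_prod big_seq; apply: rpred_prod => x xt.
  by rewrite hornerXsubC rpredB //; apply: tr.
have step y t :
   (\prod_(x <- y :: t) ('X - x%:P))^`().[z] ^+ 2 -
   (\prod_(x <- y :: t) ('X - x%:P)).[z] * (\prod_(x <- y :: t) ('X - x%:P))^`(2).[z]
   = (\prod_(x <- t) ('X - x%:P)).[z] ^+ 2 + (z - y) ^+ 2 * (
   (\prod_(x <- t) ('X - x%:P))^`().[z] ^+ 2 -
   (\prod_(x <- t) ('X - x%:P)).[z] * (\prod_(x <- t) ('X - x%:P))^`(2).[z]).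
  rewrite big_cons !derivnS derivn0 !(derivXsubC_mul, derivD).
  by rewrite !(hornerD, hornerXsubC_mul); ring.
case: s s0 sr Qz => [//|y s] _ sr Qz; rewrite step.
have yr : y \is Num.real by apply: sr; rewrite mem_head.
have {}sr x : x \in s -> x \is Num.real by move=> xs; apply: sr; rewrite inE xs orbT.
apply: ltr_wpDr.
  rewrite mulr_ge0 ?real_exprn_even_ge0 ?rpredB // {Qz}.
  elim: s sr => [|x s IH] sr.
    by rewrite big_nil -polyC1 !derivnS derivn0 !derivC horner0 mulr0 subr0 expr0n.
  have sr' u : u \in s -> u \is Num.real by move=> us; apply: sr; rewrite inE us orbT.
  rewrite step addr_ge0 ?real_exprn_even_ge0 ?Qr //.
  by rewrite mulr_ge0 ?IH ?real_exprn_even_ge0 ?rpredB // sr ?mem_head.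
rewrite real_exprn_even_gt0 ?Qr //=; apply: contraNneq Qz => Q0.
by rewrite big_cons hornerXsubC_mul Q0 mulr0.
Qed.

(** Continuity at 0 made explicit. The order on [R[i]] is partial and [p.[h%:C]] may fail to be
    real, so the conclusion is a negated inequality. *)
Lemma horner_lt0_near0 (R : rcfType) (p : {poly R[i]}) :
  p.[0] < 0 -> exists2 h : R, 0 < h & ~~ (0 <= p.[h%:C]).
Proof.
move=> p0; have /factor_theorem[q pE] : root (p - p.[0]%:P) 0.
  by rewrite /root hornerD hornerN hornerC subrr.
pose B := \sum_(i < size q) Normc.normc q`_i.
have B0 : 0 <= B by apply: sumr_ge0 => i _; case: q`_i => ? ?; exact: sqrtr_ge0.
have qB (h : R) : 0 <= h <= 1 -> `|q.[h%:C]| <= B%:C.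
  move=> /andP[h0 h1]; rewrite horner_coef (le_trans (ler_norm_sum _ _ _)) //.
  rewrite /B rmorph_sum; apply: ler_sum => i _ /=.
  rewrite normrM -[leRHS]mulr1 ler_wpM2l //.
  by rewrite normrX exprn_ile1 //= -?lecR ?ger0_norm ?ler0c ?lecR.
pose d := - complex.Re p.[0].
have dE : p.[0] = - d%:C.
  have /eqP : `|p.[0]| = - p.[0] by rewrite ltr0_norm.
  move: p0; rewrite /d ltcE; case: p.[0] => x y /= /andP[/eqP <- _] _.
  by apply/eqP; rewrite eq_complex /= opprK oppr0 !eqxx.
have d0 : 0 < d by move: p0; rewrite dE oppr_lt0 ltcR.
have B1 : 0 < B + 1 + d by lra.
(* On [0, 1] the value moves by at most [h * B] from [- d]; this [h] is at most 1 and keeps [h * B]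
   below [d]. *)
exists (d / (B + 1 + d)); first by rewrite divr_gt0.
set h := d / _; have h0 : 0 < h by rewrite divr_gt0.
have h1 : h <= 1 by rewrite ler_pdivrMr // mul1r; lra.
have hB : h * B < d.
  by rewrite /h mulrAC ltr_pdivrMr // ltr_pM2l //; lra.
apply/negP => ph.
have : p.[h%:C] = - d%:C + q.[h%:C] * h%:C.
  move/(congr1 (horner^~ h%:C)): pE.
  rewrite hornerD hornerN hornerC hornerM hornerXsubC subr0 dE => <-.
  by rewrite opprK addrCA addNr addr0.
move=> E; move: ph; rewrite E addrC subr_ge0 => ph.
have : d%:C <= (h * B)%:C.
  apply: (le_trans (le_trans ph (real_ler_norm _))) => //.
  - by rewrite realE (le_trans _ ph) // ler0c ltW.
  - rewrite normrM [(h * B)%:C](rmorphM (real_complex R)) /= mulrC.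
    by rewrite ger0_norm ?ler0c ?(ltW h0) // ler_wpM2l ?ler0c ?(ltW h0) ?qB ?(ltW h0).
by rewrite lecR; lra.
Qed.

(** * The ellipse *)

(** The points [f k] give [size p] distinct roots in the segment, one more than the degree
    allows. *)
Lemma poly_eq0_segment (R : rcfType) (alpha beta : R) (p : {poly R[i]}) :
  alpha < beta -> (forall x, alpha <= x <= beta -> p.[x%:C] = 0) -> p = 0.
Proof.
move=> ab p0; apply/eqP/negPn/negP => pN0.
pose f k : R[i] := (alpha + (beta - alpha) / k.+1%:R)%:C.
pose rs := [seq f k | k <- iota 0 (size p)].
suff [pr ur] : all (root p) rs /\ uniq rs.
  by have := max_poly_roots pN0 pr ur; rewrite size_map size_iota ltnn.
have k0 k : 0 < k.+1%:R^-1 :> R by rewrite invr_gt0 ltr0n.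
have k1 k : k.+1%:R^-1 <= 1 :> R by rewrite invf_le1 ?ler1n ?ltr0n.
split.
  apply/allP => _ /mapP[k _ ->]; apply/eqP/p0.
  have ab0 : 0 <= beta - alpha by rewrite subr_ge0 ltW.
  rewrite lerDl mulr_ge0 ?(ltW (k0 k)) //= -lerBrDl.
  by rewrite ler_piMr.
rewrite map_inj_uniq ?iota_uniq // => i j /complexI /addrI /mulfI.
by rewrite subr_eq0 gt_eqF // => /(_ isT)/invr_inj/eqP; rewrite eqr_nat => /eqP[].
Qed.

Lemma conjc_unit (R : rcfType) (w : R[i]) : Normc.normc w = 1 -> conjc w = w^-1.
Proof.
move=> w1; rewrite invc_norm -[`|w|]/((Normc.normc w)%:C) w1.
by rewrite -exprVn invr1 expr1n mul1r.
Qed.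

(* On [alpha, beta] the combinations U and V below equal D / w and D * w, so
   U * V is constant; if D != 0, then P is constant too. *)
Lemma ellipse_preimage_real (R : rcfType) (P : {poly R[i]}) (a c : R[i])
    (alpha beta : R) :
  P \is monic -> (1 < size P)%N -> alpha < beta ->
  (forall x, alpha <= x <= beta ->
    exists2 w, Normc.normc w = 1 & P.[x%:C] = a * w^-1 + c * w) ->
  a = conjc c.
Proof.
move=> Pm P1 ab HP.
(* At a real point [Q] takes the conjugate of the value of [P], and the conjugate of [w] is
   [w^-1]. *)
pose Q := map_poly (@conjc R) P.
pose D := a * conjc a - c * conjc c.
pose U := (conjc a) *: P - c *: Q.
pose V := a *: Q - (conjc c) *: P.
have HUV x : alpha <= x <= beta ->
    exists2 w, w != 0 & U.[x%:C] = D * w^-1 /\ V.[x%:C] = D * w.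
  move=> /HP[w w1 Px]; exists w.
    by apply: contra_eq_neq w1 => ->; rewrite Normc.normc0 eq_sym oner_eq0.
  have Qx : Q.[x%:C] = conjc a * w + conjc c * w^-1.
    rewrite -[x%:C]conjc_real horner_map Px rmorphD !rmorphM /= -conjc_unit //.
    by rewrite conjcK.
  by rewrite /U /V !hornerE Px Qx /D; split; ring.
(* When |a| = |c|, [U] vanishes on the segment, hence identically; as [P] is monic, the top
   coefficient of [U] is [conjc a - c]. *)
have [D0|D0] := eqVneq D 0.
  have U0 : U = 0.
    by apply: poly_eq0_segment ab _ => x /HUV[w _ [-> _]]; rewrite D0 mul0r.
  have Pn : P`_(size P).-1 = 1 by rewrite -lead_coefE (monicP Pm).
  have : conjc a * P`_(size P).-1 - c * conjc (P`_(size P).-1) = 0.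
    have := congr1 (fun p : {poly R[i]} => p`_(size P).-1) U0.
    by rewrite coef0 coefB !coefZ coef_map.
  by rewrite Pn conjc1 !mulr1 => /subr0_eq <-; rewrite conjcK.
have UV : U * V = (D ^+ 2)%:P.
  apply/subr0_eq; apply: poly_eq0_segment ab _ => x /HUV[w w0 [Ux Vx]].
  rewrite hornerD hornerN hornerC hornerM Ux Vx mulrACA mulVf // mulr1.
  by rewrite -expr2 subrr.
have UV0 : U * V != 0 by rewrite UV polyC_eq0 expf_neq0.
have /andP[U0 V0] : (U != 0) && (V != 0) by rewrite -negb_or -mulf_eq0.
(* Factors of a nonzero constant are constant, hence so is [D *: P], against [1 < size P]. *)
have : (size U + size V).-1 = 1%N.
  by rewrite -size_mul // UV size_polyC expf_neq0.
have := size_poly_gt0 U; have := size_poly_gt0 V; rewrite U0 V0 => sV sU sUV.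
have PE : D *: P = a *: U + c *: V.
  by apply/polyP => i; rewrite !(coefD, coefN, coefZ) /D; ring.
have : (size (D *: P) <= 1)%N.
  rewrite PE (leq_trans (size_polyD _ _)) // geq_max.
  by rewrite !(leq_trans (size_scale_leq _ _)) //; lia.
by rewrite size_scale // leqNgt P1.
Qed.

(** Numbers of [R[i]] are comparable only when their imaginary parts agree, so an order interval
    with real ends consists of reals. This allows membership in [-rho, rho] to be written with [<=]
    below. *)
Lemma complex_segmentP (R : rcfType) (x y : R) (z : R[i]) :
  reflect (exists2 t, x <= t <= y & z = t%:C) (x%:C <= z <= y%:C).
Proof.
apply: (iffP andP) => [|[t /andP[xt ty] ->]]; last by rewrite !lecR.
case: z => t s; rewrite !lecE /= => -[/andP[/eqP s0 xt] /andP[_ ty]].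
by exists t; [rewrite xt ty | rewrite s0].
Qed.

(** On the unit circle [a / w] is the conjugate of [c w], so the sum is [2 Re (c w)], where
    [|c w| = |a|]. *)
Lemma degenerate_ellipse (R : rcfType) (a c y : R[i]) :
  a = conjc c -> a != 0 ->
  (exists2 w, Normc.normc w = 1 & y = a * w^-1 + c * w) <->
  (- (2 * Normc.normc a))%:C <= y <= (2 * Normc.normc a)%:C.
Proof.
move=> -> c0; set r := Normc.normc _.
have rc : Normc.normc c = r by rewrite /r; case: (c) => u v /=; rewrite sqrrN.
have {}c0 : c != 0 by rewrite -conjc_eq0.
have r0 : 0 < r by rewrite -rc normc_gt0.
split=> [[w w1 ->]|/complex_segmentP[t tr ->]].
  rewrite -conjc_unit // -rmorphM addrC addcJ.
  have : Normc.normc (c * w) = r by rewrite Normc.normcM w1 mulr1.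
  case: (c * w) => u v /= uv; apply/complex_segmentP; exists (2 * u).
    have : `|u| <= r by rewrite -uv -sqrtr_sqr ler_wsqrtr // lerDl sqr_ge0.
    by rewrite ler_norml; lra.
  by rewrite rmorphM rmorph_nat.
(* A point of the circle of radius [r] with real part [t / 2]; then [w = z / c]. *)
pose z := (t / 2) +i* Num.sqrt (r ^+ 2 - (t / 2) ^+ 2).
have zr : Normc.normc z = r.
  rewrite /z /= sqr_sqrtr; last by rewrite subr_sqr mulr_ge0 //; lra.
  by rewrite addrC subrK sqrtr_sqr gtr0_norm.
have w1 : Normc.normc (z / c) = 1.
  by rewrite Normc.normcM Normc.normcV rc zr divff // gt_eqF.
exists (z / c) => //; rewrite -conjc_unit // -rmorphM mulrC divfK // addrC addcJ /=.
by rewrite rmorphM fmorphV rmorph_nat mulrC divfK // pnatr_eq0.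
Qed.

(** * Polynomials whose preimage of a segment is a segment *)

Lemma real_ler_sqr_seg (F : numDomainType) (x y : F) :
  x \is Num.real -> 0 <= y -> (x ^+ 2 <= y ^+ 2) = (- y <= x <= y).
Proof.
by move=> xr y0; rewrite -real_ler_norml // -[RHS]ler_sqr ?nnegrE // real_normK.
Qed.

Lemma size_deriv_num (F : numDomainType) (p : {poly F}) : size p^`() = (size p).-1.
Proof.
have [->|p0] := eqVneq p 0; first by rewrite deriv0 size_poly0.
have [/size1_polyC->|p1] := leqP (size p) 1.
  by rewrite derivC size_poly0 size_polyC; case: eqP.
rewrite /deriv size_poly_eq // prednK; last by case: (size p) p1.
by rewrite -lead_coefE mulrn_eq0 lead_coef_eq0 (negPf p0) orbF; lia.
Qed.

Section RealPreimage.
Variables (R : rcfType) (P : {poly R[i]}) (rho alpha beta : R).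
Hypotheses (Pm : P \is monic) (P1 : (1 < size P)%N) (rho0 : 0 < rho).
Hypothesis preim : forall z,
  (- rho)%:C <= P.[z] <= rho%:C <-> exists2 x, alpha <= x <= beta & z = x%:C.

Let lt_rho : (- rho)%:C < rho%:C.
Proof. by rewrite ltcR gtrN. Qed.

Let zero_in : (- rho)%:C <= (0 : R[i]) <= rho%:C.
Proof. by rewrite !lecR oppr_le0 ltW. Qed.

(** A root of [P - t] is a preimage of [t], hence lies on the real segment. *)
Lemma prod_XsubC_preimage (t : R[i]) : (- rho)%:C <= t <= rho%:C ->
  exists s : seq R[i],
   [/\ P - t%:P = \prod_(x <- s) ('X - x%:P), s != [::] &
    forall z, z \in s -> exists2 x, alpha <= x <= beta & z = x%:C].
Proof.
move=> tr; have [s sE] := closed_field_poly_normal (P - t%:P).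
have sz : (size (- t%:P) < size P)%N.
  by rewrite size_polyN (leq_ltn_trans (size_polyC_leq1 _)).
have lc : lead_coef (P - t%:P) = 1 by rewrite lead_coefDl // (monicP Pm).
rewrite lc scale1r in sE; exists s; split=> //.
  apply: contraTneq P1 => s0; have := size_polyDl sz.
  by rewrite sE s0 big_nil size_poly1 => <-.
move=> z zs; apply/preim.
have : root (P - t%:P) z by rewrite sE root_prod_XsubC.
by rewrite /root hornerD hornerN hornerC subr_eq0 => /eqP ->.
Qed.

Lemma preimage_horner_real (x : R) : P.[x%:C] \is Num.real.
Proof.
have [s [sE _ sr]] := prod_XsubC_preimage _ zero_in.
move: sE; rewrite subr0 => ->; rewrite horner_prod big_seq rpred_prod // => y.
by move=> /sr[u _ ->]; rewrite hornerXsubC -rmorphB complex_real.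
Qed.

Lemma critical_preimage (z : R[i]) : P^`().[z] = 0 ->
  (exists2 x, alpha <= x <= beta & z = x%:C) /\
  ((P.[z] = rho%:C /\ P^`(2).[z] < 0) \/ (P.[z] = (- rho)%:C /\ 0 < P^`(2).[z])).
Proof.
move=> P'z.
have zr : exists2 x, alpha <= x <= beta & z = x%:C.
  have [s [sE s0 sr]] := prod_XsubC_preimage _ zero_in.
  rewrite subr0 in sE.
  (* By Gauss-Lucas no open half-plane separates [z] from the segment; the directions i, -i, -1 and
     1 below confine [z] to it. *)
  have noe e : ~ (forall x, alpha <= x <= beta -> 0 < complex.Re (e * (z - x%:C))).
    move=> He; have := @deriv_prod_XsubC_neq0 _ e z s s0.
    rewrite -sE P'z eqxx => /(_ _)/notF; apply => y /sr[x xab ->].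
    exact: He.
  case: z {P'z} noe => u v noe.
  have [v0|v0|v0] := ltrgtP v 0.
  - by case: (noe (0 +i* 1)) => x _ /=; lra.
  - by case: (noe (0 -i* 1)) => x _ /=; lra.
  exists u; last by rewrite v0.
  apply/andP; split; rewrite leNgt; apply/negP => lt.
  - by case: (noe (- 1)) => x /= /andP[]; lra.
  - by case: (noe 1) => x /= /andP[]; lra.
split=> //.
(* Laguerre's inequality for [P - t], where the square of the derivative drops out. With [P.[z]]
   strictly inside, the two ends [t] would force opposite signs on [P'']. *)
have lag t : (- rho)%:C <= t <= rho%:C -> P.[z] != t ->
    0 < (t - P.[z]) * P^`(2).[z].
  move=> tr Pzt; have [s [sE s0 sr]] := prod_XsubC_preimage _ tr.
  have := @laguerre_prod_XsubC _ z s s0; rewrite -sE.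
  rewrite !derivnS derivn0 derivB derivC subr0 P'z expr0n sub0r.
  rewrite hornerD hornerN hornerC -mulNr opprB; apply.
  - by have [x _ ->] := zr; rewrite complex_real.
  - by move=> y /sr[x _ ->]; rewrite complex_real.
  - by rewrite subr_eq0.
have /andP[Pl Pu] : (- rho)%:C <= P.[z] <= rho%:C by apply/preim.
have [Pze|Pzu] := eqVneq P.[z] rho%:C.
  left; split=> //; have := lag (- rho)%:C; rewrite lexx ltW // Pze gt_eqF //.
  by move=> /(_ isT isT); rewrite nmulr_rgt0 // subr_lt0.
have [Pze|Pzl] := eqVneq P.[z] (- rho)%:C.
  right; split=> //; have := lag rho%:C; rewrite lexx ltW // Pze lt_eqF //.
  by move=> /(_ isT isT); rewrite pmulr_rgt0 // subr_gt0.
have {}Pl : (- rho)%:C < P.[z] by rewrite lt_neqAle eq_sym Pzl.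
have {}Pu : P.[z] < rho%:C by rewrite lt_neqAle Pzu.
have := lag rho%:C; rewrite lexx ltW // pmulr_rgt0 ?subr_gt0 // => /(_ isT Pzu) P2p.
have := lag (- rho)%:C; rewrite lexx ltW // nmulr_rgt0 ?subr_lt0 // => /(_ isT Pzl).
by move=> /(lt_trans P2p); rewrite ltxx.
Qed.


(** [P''] vanishes at no stationary point, so the roots of [P'] are simple and their number is its
    degree. *)
Lemma stationary_preimage_seq : exists s : seq R[i],
  [/\ uniq s, size s = (size P).-2 & forall z, (z \in s) = (P^`().[z] == 0)].
Proof.
have [s sE] := closed_field_poly_normal P^`().
have szP' : size P^`() = (size P).-1 by exact: size_deriv_num.
have P'0 : P^`() != 0 by rewrite -size_poly_gt0 szP'; lia.
have lc0 : lead_coef P^`() != 0 by rewrite lead_coef_eq0.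
have sP' z : (z \in s) = (P^`().[z] == 0).
  by rewrite -root_prod_XsubC /root sE hornerZ mulf_eq0 (negPf lc0).
exists s; split=> //; last first.
  by move: szP'; rewrite sE size_scale // size_prod_XsubC => <-.
rewrite -separable_prod_XsubC unlock.
apply: Pdiv.ClosedField.root_coprimep => z; rewrite root_prod_XsubC sP' => /eqP P'z.
have : P^`(2).[z] != 0.
  by have [_ [[_ /lt_eqF->]|[_ /gt_eqF->]]] := critical_preimage _ P'z.
apply: contraNneq; rewrite !derivnS derivn0 sE derivZ hornerZ => ->.
by rewrite mulr0.
Qed.

(** [P] is real on the real axis; a square below [rho ^ 2] would put its value in [-rho, rho] and
    [x] in the segment. *)
Lemma sqr_preimage_outside (x : R) : ~~ (alpha <= x <= beta) ->
  0 <= (P ^+ 2 - (rho%:C ^+ 2)%:P).[x%:C].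
Proof.
move=> xab; have Pr := preimage_horner_real x.
rewrite hornerD hornerN hornerC horner_exp subr_ge0.
rewrite real_leNgt ?rpredX ?complex_real //; apply/negP => lt.
have /preim[y yab /complexI xy] : (- rho)%:C <= P.[x%:C] <= rho%:C.
  by rewrite rmorphN -real_ler_sqr_seg ?ler0c ?(ltW rho0) // ltW.
by move: xab; rewrite xy yab.
Qed.

(* [d] points from the endpoint [e] out of the segment, where P ^ 2 > rho ^ 2. *)
Lemma preimage_endpoint (e d : R) : alpha <= e <= beta -> d != 0 ->
  (forall h, 0 < h -> ~~ (alpha <= e + h * d <= beta)) ->
  (P.[e%:C] = rho%:C \/ P.[e%:C] = (- rho)%:C) /\ P^`().[e%:C] != 0.
Proof.
move=> eab d0 Hd; pose D := P ^+ 2 - (rho%:C ^+ 2)%:P.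
(* Continuity along the ray from [e] in the direction [d], by substituting [e + d X]. *)
have near (G : {poly R[i]}) : G.[e%:C] < 0 ->
    exists2 h, 0 < h & ~~ (0 <= G.[(e + h * d)%:C]).
  move=> Ge; have := @horner_lt0_near0 _ (G \Po (e%:C%:P + d%:C *: 'X)).
  rewrite horner_comp !hornerE ?mulr0 ?addr0 => /(_ Ge)[h h0].
  rewrite horner_comp !hornerE => H; exists h => //.
  by rewrite rmorphD rmorphM mulrC.
have De : D.[e%:C] = 0.
  have : P.[e%:C] ^+ 2 <= rho%:C ^+ 2.
    have : (- rho)%:C <= P.[e%:C] <= rho%:C by apply/preim; exists e.
    by rewrite rmorphN -real_ler_sqr_seg ?ler0c ?(ltW rho0) ?preimage_horner_real.
  rewrite -subr_le0 le_eqVlt => /orP[/eqP DE|Dlt].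
    by rewrite /D !hornerE.
  have [|h h0] := near D; first by rewrite /D !hornerE.
  by rewrite sqr_preimage_outside // Hd.
have Pe : P.[e%:C] = rho%:C \/ P.[e%:C] = (- rho)%:C.
  move: De; rewrite /D !hornerE => /eqP; rewrite subr_eq0 eqf_sqr.
  by move=> /orP[/eqP->|/eqP->]; [left | right; rewrite rmorphN].
(* If [P'] vanished at [e], then [D = (X - e)^2 G2] with [G2.[e] = P.[e] P''.[e]], negative by
   [critical_preimage]; [D] would fail to be nonnegative just outside the segment. *)
split=> //; apply/eqP => P'e.
have D'E : D^`() = (P * P^`()) *+ 2.
  by rewrite /D derivB derivC subr0 expr2 derivM [_^`() * _]mulrC -mulr2n.
have /factor_theorem[G1 DE] : root D e%:C by apply/eqP.
have D1 : D^`() = G1 + ('X - e%:C%:P) * G1^`() by rewrite DE mulrC derivXsubC_mul.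
have /factor_theorem[G2 G1E] : root G1 e%:C.
  apply/eqP; move/(congr1 (horner^~ e%:C)): D1.
  rewrite hornerD hornerXsubC_mul subrr mul0r addr0 => <-.
  by rewrite D'E hornerMn hornerM P'e mulr0 mul0rn.
have G2e : G2.[e%:C] = P.[e%:C] * P^`(2).[e%:C].
  move/(congr1 (fun p : {poly R[i]} => p^`().[e%:C])): D1.
  rewrite D'E G1E [G2 * _]mulrC !(derivD, derivXsubC_mul) derivM.
  rewrite !(hornerXsubC_mul, hornerM, hornerD) P'e subrr !(mul0r, mulr0) !addr0 add0r.
  rewrite !derivnS derivn0 => H.
  have two0 : 2 != 0 :> R[i] by rewrite pnatr_eq0.
  by apply: (mulfI two0); rewrite !mulr_natl !mulr2n.
have : G2.[e%:C] < 0.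
  rewrite G2e; have [_ [[-> P2]|[-> P2]]] := critical_preimage _ P'e.
  - by rewrite pmulr_rlt0 // ltcR.
  - by rewrite pmulr_llt0 // rmorphN oppr_lt0 ltcR.
move=> /near[h h0 /negP]; apply.
have : 0 <= D.[(e + h * d)%:C] by rewrite sqr_preimage_outside // Hd.
rewrite DE G1E -mulrA -expr2 hornerM horner_exp hornerXsubC -rmorphB (addrC e) addrK.
by rewrite pmulr_lge0 // -rmorphXn ltcR exprn_even_gt0 // mulf_neq0 // gt_eqF.
Qed.

End RealPreimage.

(** * The Pell equation and the Joukowski substitution *)

(** Since [D' = 2 P P'], [D] has a double root at each point of [s]; counting degrees leaves a monic
    quadratic, with roots [x] and [y]. *)
Lemma sqr_sub_factor (F : numFieldType) (P : {poly F}) (rho x y : F) (s : seq F) :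
  P \is monic -> size s = (size P).-2 -> (1 < size P)%N -> uniq s ->
  (forall z, (z \in s) = root P^`() z) ->
  (forall z, z \in [:: x, y & s] -> P.[z] ^+ 2 = rho ^+ 2) ->
  x != y -> x \notin s -> y \notin s ->
  P ^+ 2 - (rho ^+ 2)%:P =
    ('X - x%:P) * ('X - y%:P) * (\prod_(z <- s) ('X - z%:P)) ^+ 2.
Proof.
move=> Pm szs P1 us sP' Ps xy xs ys.
set W := \prod_(z <- s) _; set D := _ - _.
have rD z : z \in [:: x, y & s] -> root D z.
  by move=> /Ps Pz; rewrite /root !hornerE Pz subrr.
have rs z : z \in s -> root W z by rewrite root_prod_XsubC.
have rW' z : z \in s -> ~~ root W^`() z.
  move=> zs; have : separable_poly W by rewrite separable_prod_XsubC.
  by rewrite unlock => /coprimep_root; apply; apply: rs.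
have urs : uniq_roots s by rewrite uniq_rootsE.
have [D1 DE] : exists q, D = q * W.
  apply: uniq_roots_prod_XsubC urs; apply/allP => z zs.
  by apply: rD; rewrite !inE zs !orbT.
(* At a simple root of [W], the relation [0 = D' = D1' W + D1 W'] forces [D1] to vanish. *)
have [D2 D1E] : exists q, D1 = q * W.
  apply: uniq_roots_prod_XsubC urs; apply/allP => z zs.
  have : D^`().[z] = 0.
    rewrite /D derivB derivC subr0 expr2 derivM hornerD !hornerM.
    have : root P^`() z by rewrite -sP'.
    by move=> /eqP ->; rewrite mul0r mulr0 addr0.
  rewrite DE derivM hornerD !hornerM.
  have /eqP -> := rs _ zs; rewrite mulr0 add0r => /eqP.
  by rewrite mulf_eq0 => /orP[//|/(negP (rW' _ zs))].
have WE : size W = (size P).-1 by rewrite size_prod_XsubC szs; lia.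
have Wm : W \is monic by exact: monic_prod_XsubC.
have sz2 (p : {poly F}) : p \is monic -> size (p ^+ 2) = ((size p).-1 * 2).+1.
  by move=> /monic_neq0 p0; rewrite -size_exp prednK // size_poly_gt0 expf_neq0.
have sc : (size (- (rho ^+ 2)%:P) < size (P ^+ 2))%N.
  rewrite size_polyN (leq_ltn_trans (size_polyC_leq1 _)) //.
  by rewrite sz2 //; lia.
have DE2 : D = D2 * W ^+ 2 by rewrite DE D1E -mulrA.
have W2m : W ^+ 2 \is monic by rewrite monic_exp.
have Dm : D \is monic by rewrite monicE /D lead_coefDl // -monicE monic_exp.
have D2m : D2 \is monic by move: Dm; rewrite DE2 monicMr.
have szD2 : size D2 = 3.
  have := congr1 (fun p : {poly F} => size p) DE2.
  rewrite /D size_polyDl // (size_monicM D2m) ?monic_neq0 // !sz2 //.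
  by rewrite WE; have := size_poly_gt0 D2; rewrite monic_neq0 //; lia.
rewrite DE2; congr (_ * _).
rewrite [LHS](@all_roots_prod_XsubC _ _ [:: x; y]) //.
- by rewrite (monicP D2m) scale1r !big_cons big_nil mulr1.
- have rD2 z : z \in [:: x, y & s] -> z \notin s -> root D2 z.
    move=> /rD; rewrite DE2 rootM => /orP[//|].
    by rewrite {1}/root horner_exp expf_eq0 /= -/(root W z) root_prod_XsubC => ->.
  by rewrite /= !rD2 ?inE ?eqxx ?orbT.
- by rewrite uniq_rootsE /= inE xy.
Qed.

(** [w] and [t - w] are the two roots of [X^2 - t X + 1], hence inverse to each other. *)
Lemma joukowski_surj (F : numClosedFieldType) (t : F) :
  exists2 w, w != 0 & t = w + w^-1.
Proof.
pose w := (t + sqrtC (t ^+ 2 - 4)) / 2.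
have ww : w * (t - w) = 1.
  have := sqrtCK (t ^+ 2 - 4); rewrite /w; move: (sqrtC _) => s sE.
  have -> : (t + s) / 2 * (t - (t + s) / 2) = (t ^+ 2 - s ^+ 2) / 4 by field.
  by rewrite sE opprB addrC subrK divff // pnatr_eq0.
have w0 : w != 0 by apply: contra_eq_neq ww => ->; rewrite mul0r eq_sym oner_eq0.
by exists w => //; rewrite -[w^-1]mulr1 -ww mulKf // addrC subrK.
Qed.

(** Horner's recursion, with one factor [w] spent at each step to clear the pole of [w^-1]. *)
Lemma joukowski_homogenize (F : fieldType) (m h : F) (p : {poly F}) :
  exists k (q : {poly F}), forall w, w != 0 ->
    q.[w] = w ^+ k * p.[m + h * (w + w^-1)].
Proof.
elim/poly_ind: p => [|p c [k [q qE]]].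
  by exists 0%N, 0 => w _; rewrite !horner0 mulr0.
exists k.+1, (q * (h *: 'X^2 + m *: 'X + h%:P) + c *: 'X^(k.+1)) => w w0.
rewrite !(hornerD, hornerM, hornerZ, hornerXn, hornerX, hornerC) qE // exprS.
move: (p.[_]) => y.
by field.
Qed.

(* With z = m + h (w + 1/w) the two factors of P ^ 2 - (z - x) (z - y) Q ^ 2
   become Laurent polynomials in w with constant product, hence monomials. *)
Lemma joukowski_factor (R : rcfType) (P Q : {poly R[i]}) (rho x y : R[i]) :
  rho != 0 -> (1 < size P)%N -> x != y ->
  P ^+ 2 - (rho ^+ 2)%:P = ('X - x%:P) * ('X - y%:P) * Q ^+ 2 ->
  exists k n, [/\ (0 < n)%N, k ^+ 2 = rho ^+ 2 & forall w, w != 0 ->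
    2 * P.[(x + y) / 2 + (y - x) / 4 * (w + w^-1)] = k * (w ^+ n + w ^- n)].
Proof.
move=> rho0 P1 xy PQ; set m := (x + y) / 2; set h := (y - x) / 4.
have [kP [qP qPE]] := joukowski_homogenize _ m h P.
have [kQ [qQ qQE]] := joukowski_homogenize _ m h Q.
(* Since [(z - x)(z - y) = (h (w - 1/w))^2], the values [h] and [- h] of [e] give the two factors,
   cleared of denominators by [w ^+ k]. *)
pose G e := 'X^(kQ.+1) * qP + e *: ('X^kP * ('X^2 - 1) * qQ).
pose k := (kP + kQ).+1; pose z (w : R[i]) := m + h * (w + w^-1).
have GE e w : w != 0 ->
    (G e).[w] = w ^+ k * (P.[z w] + e * (w - w^-1) * Q.[z w]).
  move=> w0; rewrite /G !(hornerD, hornerN, hornerM, hornerZ, hornerXn, hornerX, hornerC).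
  rewrite qPE // qQE // /k -/(z w).
  rewrite !exprS !exprD; move: (P.[_]) (Q.[_]) => u v.
  by field.
have PQw w : w != 0 ->
    P.[z w] ^+ 2 - (h * (w - w^-1) * Q.[z w]) ^+ 2 = rho ^+ 2.
  move=> w0; have := congr1 (horner^~ (z w)) PQ.
  rewrite !(hornerD, hornerN, horner_exp, hornerM, hornerX, hornerC).
  rewrite !exprMn => /eqP; rewrite subr_eq => /eqP ->; rewrite addrAC.
  rewrite [X in X + _](_ : _ = 0) ?add0r //; apply/eqP; rewrite subr_eq0.
  apply/eqP; congr (_ * _); rewrite /z /m /h.
  by field.
have GG : G h * G (- h) = (rho ^+ 2) *: 'X^(k + k).
  apply/subr0_eq; apply: (@poly_eq0_segment _ 1 2) => [|u /andP[u1 _]].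
    by lra.
  have w0 : u%:C != 0 :> R[i] by rewrite gt_eqF // ltcR; lra.
  rewrite hornerD hornerN hornerM hornerZ hornerXn !GE // -(PQw _ w0) exprD.
  by ring.
(* A divisor of a power of ['X] is a monomial. *)
have [l [c GhE]] : exists l c, forall w, (G h).[w] = c * w ^+ l.
  have : G h %| ('X - 0%:P) ^+ (k + k).
    rewrite subr0 -(@dvdpZr _ (rho ^+ 2)) ?expf_neq0 // -GG; exact: dvdp_mulr.
  case/dvdp_exp_XsubCP => l _ /eqpf_eq[c _ E].
  by exists l, c => w; rewrite E subr0 hornerZ hornerXn.
have PE w : w != 0 ->
    2 * P.[z w] = c * (w ^+ l / w ^+ k + w ^+ k / w ^+ l) /\
    c ^+ 2 = rho ^+ 2.
  move=> w0; have wk0 : w ^+ k != 0 by rewrite expf_neq0.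
  have wl0 : w ^+ l != 0 by rewrite expf_neq0.
  have F1 : P.[z w] + h * (w - w^-1) * Q.[z w] = c * (w ^+ l / w ^+ k).
    by apply: (mulfI wk0); rewrite -GE // GhE mulrCA mulrCA mulrA; field.
  (* [z] is invariant under inversion of [w] while [w - 1/w] changes sign, so [G h] at [w^-1] yields
     the other factor. *)
  have zV : z w^-1 = z w by rewrite /z invrK addrC [w^-1 + w]addrC addrC.
  have F2 : P.[z w] - h * (w - w^-1) * Q.[z w] = c * (w ^+ k / w ^+ l).
    have := GE h w^-1; rewrite invr_eq0 => /(_ w0); rewrite GhE zV invrK !exprVn => E.
    have -> : P.[z w] - h * (w - w^-1) * Q.[z w] = P.[z w] + h * (w^-1 - w) * Q.[z w].
      by ring.
    by rewrite -[LHS](mulVKf wk0) -E; field; rewrite ?w0 ?wk0 ?wl0.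
  split; first by rewrite mulrDr -F1 -F2; ring.
  rewrite -(PQw _ w0) subr_sqr F1 F2; field; rewrite ?w0 ?wk0 ?wl0 //.
have [_ c2] := PE 1 (oner_neq0 _).
(* Exponent 0 would make [P] the constant [c], since every number is some [z w]. *)
have n0 n : (forall w, w != 0 -> 2 * P.[z w] = c * (w ^+ n + w ^- n)) -> (0 < n)%N.
  case: n => // E; suff Pc : P - c%:P = 0.
    by move: P1; rewrite (subr0_eq Pc) ltnNge size_polyC_leq1.
  apply: (@poly_eq0_segment _ 0 1) => [|u _]; first exact: ltr01.
  have h0 : h != 0 by rewrite mulf_neq0 ?invr_eq0 ?pnatr_eq0 // subr_eq0 eq_sym.
  have [w w0 tE] := joukowski_surj _ ((u%:C - m) / h).
  have -> : u%:C = z w by rewrite /z -tE mulrC divfK // addrC subrK.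
  have two0 : 2 != 0 :> R[i] by rewrite pnatr_eq0.
  apply/eqP; rewrite hornerD hornerN hornerC subr_eq0; apply/eqP/(mulfI two0).
  by rewrite E // expr0 invr1 mulrC.
have [kl|/ltnW lk] := leqP k l.
  have E w : w != 0 -> 2 * P.[z w] = c * (w ^+ (l - k) + w ^- (l - k)).
    move=> w0; rewrite (PE _ w0).1 -(subnK kl) addnK exprD.
    by field; rewrite ?w0 ?expf_neq0.
  by exists c, (l - k)%N; split=> //; exact: n0.
have E w : w != 0 -> 2 * P.[z w] = c * (w ^+ (k - l) + w ^- (k - l)).
  move=> w0; rewrite (PE _ w0).1 -(subnK lk) addnK exprD.
  by field; rewrite ?w0 ?expf_neq0.
by exists c, (k - l)%N; split=> //; exact: n0.
Qed.

(** By [degenerate_ellipse] with [a = c = 1], a value in [-2, 2] is also [v + 1/v] with |v| = 1; two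
    points with the same value are equal or inverse. *)
Lemma joukowski_segment (R : rcfType) (w : R[i]) : w != 0 ->
  (- 2 <= w + w^-1 <= 2) = (Normc.normc w == 1).
Proof.
move=> w0; have := @degenerate_ellipse R 1 1 (w + w^-1).
rewrite conjc1 oner_eq0 Normc.normc1 mulr1 rmorphN !rmorph_nat.
move=> /(_ erefl isT) H; apply/idP/eqP => [/H[v v1]|w1]; last first.
  by apply/H; exists w; rewrite // !mul1r addrC.
have v0 : v != 0.
  by apply: contra_eq_neq v1 => ->; rewrite Normc.normc0 eq_sym oner_eq0.
rewrite !mul1r => E; have : (w - v) * (1 - (w * v)^-1) = 0.
  have -> : (w - v) * (1 - (w * v)^-1) = (w + w^-1) - (v^-1 + v).
    by field; rewrite w0 v0.
  by rewrite E subrr.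
move/eqP; rewrite mulf_eq0 !subr_eq0 => /orP[/eqP->//|].
rewrite eq_sym invr_eq1 => /eqP wv.
by have := Normc.normcM w v; rewrite wv Normc.normc1 v1 mulr1.
Qed.

Lemma normcX (R : rcfType) (w : R[i]) n : Normc.normc (w ^+ n) = Normc.normc w ^+ n.
Proof. by elim: n => [|n IH]; rewrite ?Normc.normc1 // !exprS Normc.normcM IH. Qed.

(** In the coordinate [w], [P] is [(w^n + w^-n) rho / 2] up to sign. Its value lies in [-rho, rho]
    iff |w^n| = 1, iff |w| = 1, iff [z] lies in [alpha, beta]. *)
Lemma joukowski_preimage (R : rcfType) (P : {poly R[i]}) (rho alpha beta : R)
    (s : seq R[i]) :
  0 < rho -> P \is monic -> (1 < size P)%N -> alpha < beta ->
  uniq s -> size s = (size P).-2 -> (forall z, (z \in s) = root P^`() z) ->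
  (forall z, z \in [:: alpha%:C, beta%:C & s] ->
     P.[z] = rho%:C \/ P.[z] = (- rho)%:C) ->
  alpha%:C \notin s -> beta%:C \notin s ->
  forall z, (- rho)%:C <= P.[z] <= rho%:C <-> exists2 x, alpha <= x <= beta & z = x%:C.
Proof.
move=> rho0 Pm P1 ab us szs sP' Ps als bes z.
have alNbe : alpha%:C != beta%:C :> R[i] by rewrite lt_eqF // ltcR.
have rhoC0 : 0 < rho%:C :> R[i] by rewrite ltcR.
have rhoN0 := lt0r_neq0 rhoC0.
have Ps2 u : u \in [:: alpha%:C, beta%:C & s] -> P.[u] ^+ 2 = rho%:C ^+ 2.
  by case/Ps => ->; rewrite ?rmorphN ?sqrrN.
have [k [n [n0 k2 PE]]] := joukowski_factor _ _ _ _ _ _ rhoN0 P1 alNbe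
  (sqr_sub_factor _ _ _ _ _ _ Pm szs P1 us sP' Ps2 alNbe als bes).
pose m := (alpha%:C + beta%:C) / 2 : R[i]; pose h := (beta%:C - alpha%:C) / 4 : R[i].
have h0 : 0 < h by rewrite divr_gt0 ?ltr0n // subr_gt0 ltcR.
have [w w0 tE] := joukowski_surj _ ((z - m) / h).
have zE : z = m + h * (w + w^-1) by rewrite -tE mulrC divfK ?gt_eqF // addrC subrK.
have seg (c t : R[i]) : 0 < c -> (- (c * 2) <= c * t <= c * 2) = (- 2 <= t <= 2).
  by move=> c0; rewrite -mulrN !ler_pM2l.
have -> : ((- rho)%:C <= P.[z] <= rho%:C) = (- 2 <= w ^+ n + w ^- n <= 2).
  have two0 : 2 != 0 :> R[i] by rewrite pnatr_eq0.
  rewrite -(seg (rho%:C / 2)) ?divr_gt0 ?ltr0n // divfK // rmorphN.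
  have : P.[z] = k / 2 * (w ^+ n + w ^- n).
    by apply: (mulfI two0); rewrite zE PE // mulrA [2 * _]mulrC divfK.
  move=> ->; move/eqP: k2; rewrite eqf_sqr => /orP[/eqP->//|/eqP->].
  by rewrite !mulNr lerN2 andbC lerNl.
rewrite joukowski_segment ?expf_neq0 // normcX.
rewrite pexprn_eq1 ?(gtn_eqF n0) /=; last by case: (w) => ? ?; exact: sqrtr_ge0.
rewrite -joukowski_segment // -(seg h) //.
rewrite -[_ <= h * _ <= _]/(_ && _) -(lerD2l m) -[X in _ && X](lerD2l m) -zE.
have -> : m + - (h * 2) = alpha%:C by rewrite /m /h; field.
have -> : m + h * 2 = beta%:C by rewrite /m /h; field.
by split=> [/complex_segmentP|H] //; apply/complex_segmentP.
Qed.

(** * Square-summable sequences *)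

(** Bounding all finite partial sums by a real constant keeps the estimates free of extended reals;
    [l2normsq_leP] links this to the norm. *)
Definition sqsum_le {R : realType} (u : int -> R[i]) (C : R) : Prop :=
  forall s : seq int, uniq s -> \sum_(n <- s) Normc.normc (u n) ^+ 2 <= C.

(** [K] plays the role of the square of the operator norm. *)
Definition l2_bounded {R : realType} (L : (int -> R[i]) -> (int -> R[i])) : Prop :=
  exists2 K, 0 <= K & forall u C, sqsum_le u C -> sqsum_le (L u) (K * C).

Section SquareSummable.
Variable R : realType.
Implicit Types (u v : int -> R[i]) (C K : R) (L M : (int -> R[i]) -> int -> R[i]).

Lemma normc_ge0 (z : R[i]) : 0 <= Normc.normc z.
Proof. by case: z => ? ?; exact: sqrtr_ge0. Qed.

Lemma sqsum_le_ge0 u C : sqsum_le u C -> 0 <= C.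
Proof. by move/(_ [::] isT); rewrite big_nil. Qed.

Lemma sqsum_le_point u C n : sqsum_le u C -> Normc.normc (u n) ^+ 2 <= C.
Proof. by move/(_ [:: n] isT); rewrite big_seq1. Qed.

Lemma l2normsq_leP u C : (l2normsq u <= C%:E)%E <-> sqsum_le u C.
Proof.
split=> [uC s us|uC].
- rewrite -lee_fin; apply: le_trans uC.
  apply: esum_ge; exists [set` s]%classic; first by split=> //; exact: finite_seq.
  by rewrite -fsbig_seq // sumEFin.
- apply: ge_ereal_sup => _ [A [Afin _] <-].
  rewrite fsbig_finite //= sumEFin lee_fin; apply: uC; exact: finmap.fset_uniq.
Qed.

Lemma l2normsq_ge0 u : (0 <= l2normsq u)%E.
Proof. by apply: esum_ge0 => n _; rewrite lee_fin sqr_ge0. Qed.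

Lemma l2_sqsum_le u : l2 u -> sqsum_le u (l2norm u ^+ 2).
Proof.
move=> ul2; apply/l2normsq_leP; rewrite /l2norm sqr_sqrtr ?fine_ge0 ?l2normsq_ge0 //.
by rewrite fineK // ge0_fin_numE // l2normsq_ge0.
Qed.

Lemma sqsum_le_l2 u C : sqsum_le u C -> l2 u.
Proof. by move=> /l2normsq_leP /le_lt_trans; apply; rewrite ltry. Qed.

Lemma l2norm_sqr_le u C : sqsum_le u C -> l2norm u ^+ 2 <= C.
Proof.
move=> uC; have := sqsum_le_l2 _ _ uC; rewrite /l2 /= => ul.
rewrite /l2norm sqr_sqrtr ?fine_ge0 ?l2normsq_ge0 // -lee_fin fineK.
  exact/l2normsq_leP.
by rewrite ge0_fin_numE // l2normsq_ge0.
Qed.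

(** The weight [e] lets the coefficient of one term come arbitrarily close to 1, as the contraction
    argument requires. *)
Lemma sqr_normcD (z w : R[i]) (e : R) : 0 < e ->
  Normc.normc (z + w) ^+ 2 <=
    (1 + e) * Normc.normc z ^+ 2 + (1 + e^-1) * Normc.normc w ^+ 2.
Proof.
move=> e0; have := le_normcD z w; set x := Normc.normc z; set y := Normc.normc w => H.
apply: (@le_trans _ _ ((x + y) ^+ 2)).
  by rewrite ler_sqr ?nnegrE ?addr_ge0 ?normc_ge0.
rewrite -subr_ge0 (_ : _ - _ = e^-1 * (e * x - y) ^+ 2).
  by rewrite mulr_ge0 ?sqr_ge0 // invr_ge0 ltW.
by field; rewrite gt_eqF.
Qed.

Lemma sqsum_leD u v C D (e : R) : 0 < e -> sqsum_le u C -> sqsum_le v D ->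
  sqsum_le (fun n => u n + v n) ((1 + e) * C + (1 + e^-1) * D).
Proof.
move=> e0 uC vD s us.
apply: (@le_trans _ _ (\sum_(n <- s) ((1 + e) * Normc.normc (u n) ^+ 2 +
   (1 + e^-1) * Normc.normc (v n) ^+ 2))).
  by apply: ler_sum => n _; exact: sqr_normcD.
rewrite big_split /= -!mulr_sumr; apply: lerD; rewrite ler_wpM2l ?uC ?vD //.
  by rewrite addr_ge0 // ltW.
by rewrite addr_ge0 ?invr_ge0 // ltW.
Qed.

Lemma sqsum_le_bounded_mul u (f : int -> R[i]) K C :
  (forall n, Normc.normc (f n) <= K) -> sqsum_le u C ->
  sqsum_le (fun n => f n * u n) (K ^+ 2 * C).
Proof.
move=> fK uC s us; have K0 : 0 <= K by exact: le_trans (normc_ge0 (f 0)) (fK 0).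
apply: (@le_trans _ _ (K ^+ 2 * \sum_(n <- s) Normc.normc (u n) ^+ 2)); last first.
  by rewrite ler_wpM2l ?sqr_ge0 ?uC.
rewrite mulr_sumr; apply: ler_sum => n _; rewrite Normc.normcM exprMn.
by rewrite ler_wpM2r ?sqr_ge0 // ler_sqr ?nnegrE ?normc_ge0.
Qed.

Lemma sqsum_leZ u (k : R[i]) C : sqsum_le u C ->
  sqsum_le (fun n => k * u n) (Normc.normc k ^+ 2 * C).
Proof. exact: sqsum_le_bounded_mul. Qed.

Lemma sqsum_le_shift u (d : int) C : sqsum_le u C -> sqsum_le (fun n => u (n + d)) C.
Proof.
move=> uC s us; have := uC [seq n + d | n <- s]; rewrite big_map; apply.
by rewrite map_inj_uniq //; exact: addIr.
Qed.

Lemma l2_bounded0 : l2_bounded (fun _ _ => 0 : R[i]).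
Proof.
exists 0 => // u C _ s _; rewrite mul0r big1 // => n _.
by rewrite Normc.normc0 expr0n.
Qed.

Lemma l2_bounded_id : l2_bounded (@id (int -> R[i])).
Proof. by exists 1 => // u C; rewrite mul1r. Qed.

Lemma l2_bounded_shift (d : int) : l2_bounded (fun (u : int -> R[i]) n => u (n + d)).
Proof. by exists 1 => // u C /(sqsum_le_shift u d); rewrite mul1r. Qed.

Lemma l2_bounded_mul (f : int -> R[i]) L K :
  (forall n, Normc.normc (f n) <= K) -> l2_bounded L ->
  l2_bounded (fun u n => f n * L u n).
Proof.
move=> fK [M M0 LM]; exists (K ^+ 2 * M); first by rewrite mulr_ge0 ?sqr_ge0.
by move=> u C /LM /sqsum_le_bounded_mul -/(_ _ _ fK); rewrite mulrA.
Qed.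

Lemma l2_bounded_comp L M : l2_bounded L -> l2_bounded M -> l2_bounded (L \o M).
Proof.
move=> [K K0 LK] [K' K'0 MK]; exists (K * K'); first exact: mulr_ge0.
by move=> u C /MK/LK; rewrite mulrA.
Qed.

Lemma l2_boundedD L M : l2_bounded L -> l2_bounded M ->
  l2_bounded (fun u n => L u n + M u n).
Proof.
move=> [K K0 LK] [K' K'0 MK]; exists (2 * K + 2 * K').
  by rewrite addr_ge0 ?mulr_ge0.
move=> u C uC.
have -> : (2 * K + 2 * K') * C = (1 + 1) * (K * C) + (1 + 1^-1) * (K' * C).
  by rewrite invr1; ring.
exact: sqsum_leD (LK _ _ uC) (MK _ _ uC).
Qed.

Lemma l2_bounded_sum (I : Type) (r : seq I) (L : I -> (int -> R[i]) -> (int -> R[i])) :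
  (forall i, l2_bounded (L i)) -> l2_bounded (fun u n => \sum_(i <- r) L i u n).
Proof.
move=> LB; elim: r => [|i r IH].
  have -> : (fun u n => \sum_(i <- [::]) L i u n) = (fun _ _ => 0).
    by apply/funext => u; apply/funext => n; rewrite big_nil.
  exact: l2_bounded0.
have -> : (fun u n => \sum_(j <- i :: r) L j u n) =
    (fun u n => L i u n + \sum_(j <- r) L j u n).
  by apply/funext => u; apply/funext => n; rewrite big_cons.
exact: (l2_boundedD _ _ (LB i) IH).
Qed.

(** An operator chosen according to the index is a finite sum of operators cut off by indicator
    functions. *)
Lemma l2_bounded_select (I : finType) (L : I -> (int -> R[i]) -> (int -> R[i]))
    (i : int -> I) :
  (forall i, l2_bounded (L i)) -> l2_bounded (fun u n => L (i n) u n).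
Proof.
move=> LB.
have -> : (fun u n => L (i n) u n) =
    (fun u n => \sum_j (i n == j)%:R * L j u n).
  apply/funext => u; apply/funext => n.
  rewrite (bigD1 (i n)) //= eqxx mul1r big1 ?addr0 // => j.
  by rewrite eq_sym => /negPf ->; rewrite mul0r.
apply: l2_bounded_sum => j; apply: (@l2_bounded_mul _ _ 1) => // n.
by case: (_ == _); rewrite ?Normc.normc1 ?Normc.normc0.
Qed.

End SquareSummable.

(** * Polynomials in the shift *)

(** ['X] acts as the backward shift by [N], which makes sequences a module over the polynomials. *)
Definition poly_shift {R : realType} (N : nat) (p : {poly R[i]}) (u : int -> R[i]) :
    int -> R[i] :=
  fun n => \sum_(l < size p) p`_l * u (n - l%:Z * N%:Z).

Section PolyShift.
Variables (R : realType) (N : nat).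
Implicit Types (p q : {poly R[i]}) (u v : int -> R[i]).

Lemma poly_shift_widen p u n m : (size p <= m)%N ->
  poly_shift N p u n = \sum_(l < m) p`_l * u (n - l%:Z * N%:Z).
Proof.
move=> pm; rewrite /poly_shift (big_ord_widen m (fun l => p`_l * u (n - l%:Z * N%:Z))) //.
rewrite [RHS](bigID (fun l : 'I_m => (l < size p)%N)) /= [X in _ + X]big1 ?addr0 //.
by move=> l; rewrite -leqNgt => /(nth_default 0) ->; rewrite mul0r.
Qed.

Lemma poly_shift0 u : poly_shift N 0 u = fun=> 0.
Proof. by apply/funext => n; rewrite /poly_shift size_poly0 big_ord0. Qed.

Lemma poly_shiftD p q u n :
  poly_shift N (p + q) u n = poly_shift N p u n + poly_shift N q u n.
Proof.
pose m := maxn (size p) (size q).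
rewrite !(@poly_shift_widen _ _ _ m) ?leq_maxl ?leq_maxr //; last first.
  by rewrite (leq_trans (size_polyD _ _)).
by rewrite -big_split /=; apply: eq_bigr => l _; rewrite coefD mulrDl.
Qed.

Lemma poly_shiftZ c p u n : poly_shift N (c *: p) u n = c * poly_shift N p u n.
Proof.
rewrite (@poly_shift_widen _ _ _ (size p)) ?size_scale_leq // mulr_sumr.
by apply: eq_bigr => l _; rewrite coefZ mulrA.
Qed.

Lemma poly_shiftMX p u :
  poly_shift N (p * 'X) u = poly_shift N p (fun n => u (n - N%:Z)).
Proof.
apply/funext => n; rewrite (@poly_shift_widen _ _ _ (size p).+1); last first.
  by rewrite (leq_trans (size_polyMleq _ _)) // size_polyX addn2.
rewrite big_ord_recl coefMX mul0r add0r; apply: eq_bigr => l _.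
by rewrite coefMX /=; congr (_ * u _); rewrite /bump /= intS; ring.
Qed.

Lemma poly_shiftC c u n : poly_shift N c%:P u n = c * u n.
Proof.
rewrite (@poly_shift_widen _ _ _ 1) ?size_polyC_leq1 // big_ord1 coefC /=.
by rewrite mul0r subr0.
Qed.

Lemma poly_shiftXn k u n : poly_shift N 'X^k u n = u (n - k%:Z * N%:Z).
Proof.
elim: k u n => [|k IH] u n.
  by rewrite expr0 -polyC1 poly_shiftC mul1r mul0r subr0.
by rewrite exprSr poly_shiftMX IH intS; congr u; ring.
Qed.

Lemma poly_shift_translate p u n d :
  poly_shift N p (fun m => u (m + d)) n = poly_shift N p u (n + d).
Proof. by apply: eq_bigr => l _; congr (_ * u _); ring. Qed.

Lemma poly_shift_suml (I : Type) (r : seq I) (p : I -> {poly R[i]}) u n :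
  poly_shift N (\sum_(i <- r) p i) u n = \sum_(i <- r) poly_shift N (p i) u n.
Proof.
apply: (big_morph (fun p => poly_shift N p u n)); first by move=> ? ?; exact: poly_shiftD.
by rewrite poly_shift0.
Qed.

Lemma poly_shift_sumr (I : Type) (r : seq I) p (u : I -> int -> R[i]) n :
  poly_shift N p (fun m => \sum_(i <- r) u i m) n =
  \sum_(i <- r) poly_shift N p (u i) n.
Proof.
by rewrite /poly_shift exchange_big /=; apply: eq_bigr => l _; rewrite mulr_sumr.
Qed.

Lemma poly_shiftM p q u : poly_shift N (p * q) u = poly_shift N p (poly_shift N q u).
Proof.
apply/funext; elim/poly_ind: p u => [|p c IH] u n.
  by rewrite mul0r !poly_shift0.
rewrite mulrDl -mulrA [_ * q]mulrC mulrA mul_polyC !poly_shiftD poly_shiftZ poly_shiftC.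
rewrite !poly_shiftMX IH; congr (_ + _); congr poly_shift.
by apply/funext => m; exact: poly_shift_translate.
Qed.

Lemma poly_shift_bounded p : l2_bounded (poly_shift N p).
Proof.
apply: (@l2_bounded_sum _ _ _
  (fun l : 'I_(size p) => fun u n => p`_l * u (n - l%:Z * N%:Z))) => l.
apply: (@l2_bounded_mul _ (fun=> p`_l) (fun u n => u (n - l%:Z * N%:Z))) => //.
exact: l2_bounded_shift.
Qed.

(** Shifts by multiples of [N] do not mix residue classes. *)
Lemma eq_poly_shift_coset p u v (r : int) :
  (forall k : int, u (k * N%:Z + r) = v (k * N%:Z + r)) ->
  forall k : int, poly_shift N p u (k * N%:Z + r) = poly_shift N p v (k * N%:Z + r).
Proof.
move=> uv k; apply: eq_bigr => l _; congr (_ * _).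
by rewrite (_ : _ - _ = (k - l%:Z) * N%:Z + r) ?uv //; ring.
Qed.

End PolyShift.

(** * Inverting polynomials in the shift *)

Definition cvgc {R : realType} (f : nat -> R[i]) (l : R[i]) : Prop :=
  ((fun k => complex.Re (f k)) @ \oo --> complex.Re l)%classic /\
  ((fun k => complex.Im (f k)) @ \oo --> complex.Im l)%classic.

Section ComplexLimits.
Variable R : realType.
Implicit Types (f g : nat -> R[i]) (l m : R[i]).

Lemma cvgc_unique f l m : cvgc f l -> cvgc f m -> l = m.
Proof.
move=> [fl fl'] [fm fm']; apply/eqP; rewrite eq_complex; apply/andP; split.
  by apply/eqP; exact: (cvg_unique _ fl fm).
by apply/eqP; exact: (cvg_unique _ fl' fm').
Qed.

Lemma cvgc_affine f l (k z : R[i]) : cvgc f l -> cvgc (fun n => k * f n + z) (k * l + z).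
Proof.
case: k z l => k1 k2 [z1 z2] [l1 l2] [/= f1 f2]; split => /=.
- have -> : (fun n => complex.Re ((k1 +i* k2) * f n + (z1 +i* z2))) =
      (fun n => k1 * complex.Re (f n) - k2 * complex.Im (f n) + z1).
    by apply/funext => n; case: (f n).
  exact: cvgD (cvgB (cvgM (cvg_cst k1) f1) (cvgM (cvg_cst k2) f2)) (cvg_cst z1).
- have -> : (fun n => complex.Im ((k1 +i* k2) * f n + (z1 +i* z2))) =
      (fun n => k1 * complex.Im (f n) + k2 * complex.Re (f n) + z2).
    by apply/funext => n; case: (f n).
  exact: cvgD (cvgD (cvgM (cvg_cst k1) f2) (cvgM (cvg_cst k2) f1)) (cvg_cst z2).
Qed.

Lemma cvgc_shiftS f l : cvgc f l -> cvgc (fun n => f n.+1) l.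
Proof.
move=> [f1 f2]; split; first by have := f1; rewrite -cvg_shiftS.
by have := f2; rewrite -cvg_shiftS.
Qed.

Lemma cvg_normc_sqr f l : cvgc f l ->
  ((fun k => Normc.normc (f k) ^+ 2) @ \oo --> Normc.normc l ^+ 2)%classic.
Proof.
have E (z : R[i]) : Normc.normc z ^+ 2 = complex.Re z * complex.Re z + complex.Im z * complex.Im z.
  by case: z => a b /=; rewrite sqr_sqrtr ?addr_ge0 ?sqr_ge0 // !expr2.
move=> [f1 f2]; rewrite E; under eq_fun do rewrite E.
by apply: cvgD; apply: cvgM.
Qed.

Lemma Re_sum (I : Type) (r : seq I) (F : I -> R[i]) :
  complex.Re (\sum_(i <- r) F i) = \sum_(i <- r) complex.Re (F i).
Proof. by apply: (big_morph (@complex.Re R)) => // -[? ?] []. Qed.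

Lemma Im_sum (I : Type) (r : seq I) (F : I -> R[i]) :
  complex.Im (\sum_(i <- r) F i) = \sum_(i <- r) complex.Im (F i).
Proof. by apply: (big_morph (@complex.Im R)) => // -[? ?] []. Qed.

Lemma ler_Re_normc (z : R[i]) : `|complex.Re z| <= Normc.normc z.
Proof. by case: z => a b /=; rewrite -sqrtr_sqr ler_wsqrtr // lerDl sqr_ge0. Qed.

Lemma ler_Im_normc (z : R[i]) : `|complex.Im z| <= Normc.normc z.
Proof. by case: z => a b /=; rewrite -sqrtr_sqr ler_wsqrtr // lerDr sqr_ge0. Qed.

Lemma cvgc_geometric f (M q : R) : 0 <= q < 1 ->
  (forall j, Normc.normc (f j) <= M * q ^+ j) ->
  exists l, cvgc (fun k => \sum_(j < k) f j) l.
Proof.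
move=> /andP[q0 q1] fq.
have cv (h : nat -> R) : (forall j, `|h j| <= Normc.normc (f j)) ->
    cvgn (series h).
  move=> hf; apply: normed_cvg; apply: (@series_le_cvg _ _ (geometric M q)) => [j|j|j|].
  - exact: normr_ge0.
  - exact: (@le_trans _ _ (Normc.normc (f j)) _ _ (normc_ge0 _ _) (fq j)).
  - exact: (@le_trans _ _ (Normc.normc (f j)) _ _ (hf j) (fq j)).
  - by apply: is_cvg_geometric_series; rewrite ger0_norm.
have cR := cv _ (fun j => ler_Re_normc (f j)).
have cI := cv _ (fun j => ler_Im_normc (f j)).
exists (limn (series (fun j => complex.Re (f j))) +i*
        limn (series (fun j => complex.Im (f j)))); split => /=.
- have -> : (fun k => complex.Re (\sum_(j < k) f j)) = series (fun j => complex.Re (f j)).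
    by apply/funext => k; rewrite Re_sum /series /= big_mkord.
  exact: cR.
- have -> : (fun k => complex.Im (\sum_(j < k) f j)) = series (fun j => complex.Im (f j)).
    by apply/funext => k; rewrite Im_sum /series /= big_mkord.
  exact: cI.
Qed.

(** A form of Fatou's lemma: each finite sum passes to the limit. *)
Lemma sqsum_le_cvg (u : nat -> int -> R[i]) (v : int -> R[i]) (C : R) :
  (forall k, sqsum_le (u k) C) -> (forall n, cvgc (fun k => u k n) (v n)) ->
  sqsum_le v C.
Proof.
move=> uC uv s us.
have cv : ((fun k => \sum_(n <- s) Normc.normc (u k n) ^+ 2) @ \oo -->
          \sum_(n <- s) Normc.normc (v n) ^+ 2)%classic.
  elim: s {us} => [|n s IH].
    by rewrite big_nil; under eq_fun do rewrite big_nil; exact: cvg_cst.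
  rewrite big_cons; under eq_fun do rewrite big_cons.
  by apply: cvgD => //; apply: cvg_normc_sqr.
by apply: (cvgr_to_le cv); apply: nearW => k; exact: uC.
Qed.

End ComplexLimits.

(** Preimages with a uniform bound, and injectivity on [l2]: a pair that passes to compositions. The
    inverse operator itself is built in [l2_invertible_resolvent]. *)
Definition l2_invertible {R : realType} (L : (int -> R[i]) -> (int -> R[i])) : Prop :=
  (exists2 K, 0 <= K & forall f C, sqsum_le f C ->
     exists2 u, sqsum_le u (K * C) & L u = f) /\
  (forall u, l2 u -> L u = (fun=> 0) -> u = (fun=> 0)).

Section L2Invertible.
Variable R : realType.
Implicit Types (u f g : int -> R[i]) (L M : (int -> R[i]) -> int -> R[i]).

Lemma l2_bounded_l2 L u : l2_bounded L -> l2 u -> l2 (L u).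
Proof. by move=> [K _ LK] /l2_sqsum_le/LK/sqsum_le_l2. Qed.

Lemma l2_invertible_comp L M : l2_bounded M ->
  l2_invertible L -> l2_invertible M -> l2_invertible (L \o M).
Proof.
move=> Mb [[K K0 LK] Li] [[K' K'0 MK] Mi]; split; last first.
  by move=> u ul2 /Li => /(_ (l2_bounded_l2 _ _ Mb ul2)); exact: Mi.
exists (K' * K); first exact: mulr_ge0.
move=> f C /LK[v /MK[u uC <-] <-]; exists u => //.
by rewrite -mulrA.
Qed.

(** Neumann series: the partial sums [U j] all satisfy the bound [K * C], by induction on [j], and
    their pointwise limit inherits it. *)
Lemma l2_contraction (k : R[i]) (d : int) : Normc.normc k < 1 ->
  exists2 K, 0 <= K & forall g C, sqsum_le g C ->
    exists2 u, sqsum_le u (K * C) & forall n, u n = k * u (n + d) + g n.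
Proof.
move=> k1; set q := Normc.normc k in k1 *.
have q0 : 0 <= q := normc_ge0 _ k.
have q21 : q ^+ 2 < 1 by rewrite expr_lt1.
have q20 : 0 <= q ^+ 2 := sqr_ge0 q.
(* Chosen so that [(1 + e) q^2 < 1]; then [K] below solves [K = (1 + e) q^2 K + (1 + 1/e)], which
   makes the bound of [sqsum_leD] reproduce itself. *)
pose e := (1 - q ^+ 2) / 2.
have e0 : 0 < e by rewrite divr_gt0 // subr_gt0.
have D0 : 0 < 1 - (1 + e) * q ^+ 2.
  rewrite (_ : _ - _ = (1 - q ^+ 2) * (1 - q ^+ 2 / 2)); last by rewrite /e; field.
  by rewrite mulr_gt0; lra.
pose K := (1 + e^-1) / (1 - (1 + e) * q ^+ 2).
have K0 : 0 <= K.
  by apply: divr_ge0; last exact: ltW; rewrite addr_ge0 // invr_ge0 ltW.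
exists K => // g C gC.
pose U j n := \sum_(i < j) k ^+ i * g (n + i%:Z * d).
have US j n : U j.+1 n = k * U j (n + d) + g n.
  rewrite /U big_ord_recl expr0 mul1r mul0r addr0 addrC mulr_sumr; congr (_ + _).
  apply: eq_bigr => i _; rewrite exprS mulrA; congr (_ * g _).
  by rewrite /bump /= intS; ring.
have UC j : sqsum_le (U j) (K * C).
  elim: j => [|j IH].
    have KC0 : 0 <= K * C by exact: mulr_ge0 K0 (sqsum_le_ge0 _ _ _ gC).
    move=> s _; rewrite big1 // => n _.
    by rewrite /U big_ord0 Normc.normc0 expr0n.
  have -> : U j.+1 = (fun n => k * U j (n + d) + g n) by apply/funext => n.
  have -> : K * C = (1 + e) * (q ^+ 2 * (K * C)) + (1 + e^-1) * C.
    by rewrite /K; field; rewrite !gt_eqF.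
  apply: sqsum_leD => //; apply: (sqsum_leZ _ (fun n => U j (n + d))).
  exact: sqsum_le_shift.
have Ucvg n : exists l, cvgc (fun j => U j n) l.
  apply: (@cvgc_geometric _ (fun i => k ^+ i * g (n + i%:Z * d)) (Num.sqrt C) q) => [|j]; first by rewrite q0.
  rewrite Normc.normcM normcX mulrC ler_wpM2r ?exprn_ge0 //.
  rewrite -[leLHS]ger0_norm ?normc_ge0 // -sqrtr_sqr ler_wsqrtr //.
  exact: sqsum_le_point gC.
have [u uE] := choice Ucvg.
exists u; first exact: sqsum_le_cvg UC uE.
move=> n; apply: (cvgc_unique _ _ _ _ (cvgc_shiftS _ _ _ (uE n))).
under eq_fun do rewrite US.
exact: cvgc_affine.
Qed.

Lemma l2_contraction_unique (k : R[i]) (d : int) u : Normc.normc k < 1 -> l2 u ->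
  (forall n, u n = k * u (n + d)) -> u = (fun=> 0).
Proof.
move=> k1 ul2 uE; have uC := l2_sqsum_le _ _ ul2.
have : l2norm u ^+ 2 <= Normc.normc k ^+ 2 * l2norm u ^+ 2.
  apply: l2norm_sqr_le.
  have {1}-> : u = (fun n => k * u (n + d)) by apply/funext.
  by apply: (sqsum_leZ _ (fun n => u (n + d))); exact: sqsum_le_shift.
have k2 : Normc.normc k ^+ 2 < 1 by rewrite expr_lt1 // normc_ge0.
have := sqr_ge0 (l2norm u); rewrite le_eqVlt => /orP[/eqP u0 _|u0]; last first.
  by rewrite -[leLHS]mul1r ler_pM2r // leNgt k2.
apply/funext => n; apply: Normc.eq0_normc; apply/eqP.
rewrite -sqrf_eq0 eq_le sqr_ge0 andbT u0; exact: sqsum_le_point uC.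
Qed.

(** The equation is [u (n - N) - w u n = f n]. It is solved for [u (n - N)] if |w| < 1 and for [u n]
    if |w| > 1; either way a contraction results. *)
Lemma poly_shift_XsubC_invertible N (w : R[i]) : Normc.normc w != 1 ->
  l2_invertible (poly_shift N ('X - w%:P)).
Proof.
have E u n : poly_shift N ('X - w%:P) u n = u (n - N%:Z) - w * u n.
  by rewrite -polyCN poly_shiftD poly_shiftC mulNr -['X]expr1 poly_shiftXn mul1r.
case: ltgtP => // [w1|w1] _.
- split=> [|u ul2 u0].
    have [K K0 HK] := l2_contraction w N%:Z w1; exists K => // f C.
    move=> /(sqsum_le_shift _ _ N%:Z)/HK[u uC uE]; exists u => //.
    by apply/funext => n; rewrite E uE subrK addrAC subrr add0r.
  apply: (l2_contraction_unique w N%:Z) => // n.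
  have := congr1 (fun v => v (n + N%:Z)) u0; rewrite E addrK => /subr0_eq.
  by [].
- have w0 : w != 0 by apply: contraTneq w1 => ->; rewrite Normc.normc0 ltr10.
  have wV : Normc.normc w^-1 < 1 by rewrite Normc.normcV invf_lt1 // normc_gt0.
  split=> [|u ul2 u0].
    have [K K0 HK] := l2_contraction w^-1 (- N%:Z) wV.
    exists (K * Normc.normc (- w^-1) ^+ 2); first by rewrite mulr_ge0 ?sqr_ge0.
    move=> f C /(sqsum_leZ _ _ (- w^-1))/HK[u uC uE]; exists u.
      by rewrite -mulrA.
    by apply/funext => n; rewrite E (uE n); field.
  apply: (l2_contraction_unique w^-1 (- N%:Z)) => // n.
  have := congr1 (fun v => v n) u0; rewrite E => /subr0_eq ->.
  by rewrite mulKf.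
Qed.

Lemma poly_shift_invertible N (p : {poly R[i]}) : p != 0 ->
  (forall w, root p w -> Normc.normc w != 1) -> l2_invertible (poly_shift N p).
Proof.
have [s ->] := closed_field_poly_normal p.
set c := lead_coef p; rewrite scaler_eq0 negb_or => /andP[c0 _].
have rE w : root (c *: \prod_(z <- s) ('X - z%:P)) w = (w \in s).
  by rewrite rootZ // root_prod_XsubC.
move=> H; have {H rE} : forall w, w \in s -> Normc.normc w != 1.
  by move=> w ws; apply: H; rewrite rE.
rewrite -mul_polyC mulrC => H.
elim: s H => [|w s IH] H.
  rewrite big_nil mul1r; split=> [|u ul2 u0].
    exists (Normc.normc c^-1 ^+ 2); first exact: sqr_ge0.
    move=> f C fC; exists (fun n => c^-1 * f n); first exact: sqsum_leZ.
    by apply/funext => n; rewrite poly_shiftC mulVKf.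
  apply/funext => n; have := congr1 (fun v => v n) u0; rewrite poly_shiftC => /eqP.
  by rewrite mulf_eq0 (negPf c0) => /eqP.
rewrite big_cons -mulrA.
have -> : poly_shift N (('X - w%:P) * (\prod_(z <- s) ('X - z%:P) * c%:P)) =
   poly_shift N ('X - w%:P) \o poly_shift N (\prod_(z <- s) ('X - z%:P) * c%:P).
  by apply/funext => u; rewrite poly_shiftM.
apply: l2_invertible_comp; first exact: poly_shift_bounded.
- by apply: poly_shift_XsubC_invertible; apply: H; rewrite mem_head.
- by apply: IH => z zs; apply: H; rewrite inE zs orbT.
Qed.

End L2Invertible.

(** * Block decomposition of the Jacobi operator *)

Lemma site_subproof N (n : int) : (0 < N)%N -> (absz ((n - 1) %% N%:Z)%Z < N)%N.
Proof.
move=> N0; have := ltz_pmod (n - 1) (d := N%:Z) N0.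
by have := modz_ge0 (n - 1) (d := N%:Z); lia.
Qed.

(** Rows are counted from 0 and sequences from 1, hence the [n - 1]: index [n] is row [site n] of
    the cell [cell n]. *)
Definition site N (N0 : (0 < N)%N) (n : int) : 'I_N := Ordinal (site_subproof N n N0).

Definition cell (N : nat) (n : int) : int := ((n - 1) %/ N%:Z)%Z.

Section Floquet.
Variables (R : realType) (N : nat) (N0 : (0 < N)%N).
Implicit Types (u h : int -> R[i]) (U V : 'I_N -> int -> R[i]) (k n m : int).
Local Notation site := (@site N N0).

Lemma site_cellE n : n = cell N n * N%:Z + ((site n)%:Z + 1).
Proof.
rewrite /= gez0_abs; last by apply: modz_ge0; lia.
by rewrite addrA -divz_eq subrK.
Qed.

Lemma siteE k (i : 'I_N) : site (k * N%:Z + (i%:Z + 1)) = i.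
Proof.
apply/val_inj => /=; have := ltn_ord i.
by rewrite addrA addrK modzMDl modz_nat /= => /modn_small.
Qed.

(** A component of the vector of cells, kept as a sequence on all integers; [unblocks] reads it only
    at multiples of [N]. *)
Definition blocks u (j : 'I_N) : int -> R[i] := fun m => u (m + (j%:Z + 1)).

Definition unblocks U : int -> R[i] := fun n => U (site n) (n - ((site n)%:Z + 1)).

Lemma blocksK U j k : blocks (unblocks U) j (k * N%:Z) = U j (k * N%:Z).
Proof. by rewrite /blocks /unblocks siteE addrK. Qed.

Definition block_act (A : 'M[{poly R[i]}]_N) U (i : 'I_N) : int -> R[i] :=
  fun m => \sum_j poly_shift N (A i j) (U j) m.

Lemma block_actM A B U i m :
  block_act A (block_act B U) i m = block_act (A *m B) U i m.
Proof.
rewrite /block_act; under eq_bigr do rewrite poly_shift_sumr.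
rewrite exchange_big /=; apply: eq_bigr => j _.
by rewrite mxE poly_shift_suml; apply: eq_bigr => l _; rewrite poly_shiftM.
Qed.

Lemma block_act_scalar p U i m : block_act p%:M U i m = poly_shift N p (U i) m.
Proof.
rewrite /block_act (bigD1 i) //= big1 ?addr0 => [|j ji]; rewrite mxE.
  by rewrite eqxx.
by rewrite eq_sym (negPf ji) poly_shift0.
Qed.

Lemma eq_block_act A U V i k : (forall j l, U j (l * N%:Z) = V j (l * N%:Z)) ->
  block_act A U i (k * N%:Z) = block_act A V i (k * N%:Z).
Proof.
move=> UV; apply: eq_bigr => j _.
rewrite -[k * _]addr0; apply: eq_poly_shift_coset => l.
by rewrite addr0 UV.
Qed.

Definition block_op A h := unblocks (block_act A (blocks h)).

Lemma block_op_bounded A : l2_bounded (block_op A).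
Proof.
apply: (@l2_bounded_select _ _
  (fun i h n => block_act A (blocks h) i (n - (i%:Z + 1)))) => i.
apply: (@l2_bounded_sum _ _ _
  (fun j h n => poly_shift N (A i j) (blocks h j) (n - (i%:Z + 1)))) => j.
apply: (l2_bounded_comp _ (fun u n => u (n - (i%:Z + 1)))
  (poly_shift N (A i j) \o (fun u n => u (n + (j%:Z + 1))))).
  exact: l2_bounded_shift.
by apply: l2_bounded_comp; [exact: poly_shift_bounded | exact: l2_bounded_shift].
Qed.

Section Jacobi.
Variables (a b c : int -> R[i]) (z : R[i]).
Hypotheses (aN : periodic a N%:Z) (bN : periodic b N%:Z) (cN : periodic c N%:Z).

Lemma periodic_int (f : int -> R[i]) k n : periodic f N%:Z -> f (k * N%:Z + n) = f n.
Proof.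
move=> fN; have kN (j : nat) : j%:Z * N%:Z = N%:Z *+ j by rewrite -mulr_natl natz.
case: k => k; first by rewrite addrC kN periodicn.
by rewrite NegzE mulNr kN -(periodicn fN k.+1) addrAC addNr add0r.
Qed.

Lemma sum_ord_eq (F : nat -> R[i]) (p : nat) :
  \sum_(j < N) (p == j)%:R * F j = (p < N)%N%:R * F p.
Proof.
have [pN|pN] := ltnP p N; last first.
  rewrite mul0r big1 // => j _; have := ltn_ord j.
  by case: eqP => [<-|_ _]; [rewrite ltnNge pN | rewrite mul0r].
rewrite (bigD1 (Ordinal pN)) //= eqxx big1 ?addr0 // => j /negPf.
by rewrite -val_eqE /= eq_sym => ->; rewrite mul0r.
Qed.

(** A cell meets its neighbours only through the corner entries: [jacobi1] reaches back to cell
    [k - 1], [jacobiN1] ahead to cell [k + 1]. *)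
Lemma jacobi_blocks u k (i : 'I_N) :
  jacobi a b c u (k * N%:Z + (i%:Z + 1)) =
  \sum_j (jacobi0 N a b c i j * blocks u j (k * N%:Z) +
          jacobi1 N c i j * blocks u j ((k - 1) * N%:Z) +
          jacobiN1 N a i j * blocks u j ((k + 1) * N%:Z)).
Proof.
have iN := ltn_ord i; pose v l (p : nat) := u (l * N%:Z + (p%:Z + 1)).
(* Entries become Kronecker deltas in [j], so that [sum_ord_eq] evaluates the sums. The factor
   [0 < i] guards the truncated predecessor [i.-1] at [i = 0]. *)
have E (j : 'I_N) : jacobi0 N a b c i j * blocks u j (k * N%:Z) +
          jacobi1 N c i j * blocks u j ((k - 1) * N%:Z) +
          jacobiN1 N a i j * blocks u j ((k + 1) * N%:Z) =
   (i == j :> nat)%:R * (b i.+1%:Z * v k j) +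
   (i.+1 == j)%:R * (a i.+1%:Z * v k j) +
   ((0 < i)%N%:R * ((i.-1 == j)%:R * (c i%:Z * v k j)) +
   (i == 0%N :> nat)%:R * ((N.-1 == j)%:R * (c N%:Z * v (k - 1) j))) +
   (i.+1 == N)%:R * ((0%N == j)%:R * (a N%:Z * v (k + 1) j)).
  rewrite !mxE /blocks -/(v k j) -/(v (k - 1) j) -/(v (k + 1) j).
  have -> : (0 < i)%N%:R * ((i.-1 == j)%:R * (c i%:Z * v k j)) =
      (i == j.+1 :> nat)%:R * (c j.+1%:Z * v k j).
    have [->|ij] := eqVneq (i : nat) j.+1; first by rewrite eqxx !mul1r.
    rewrite mul0r; have [i0|i0] := posnP i; first by rewrite mul0r.
    have -> : (i.-1 == j) = false by lia.
    by rewrite mul0r mulr0.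
  have -> : (i == 0%N :> nat) && (j.+1 == N) = (i == 0%N :> nat) && (N.-1 == j) by lia.
  rewrite [j == 0%N :> nat]eq_sym.
  move: (v k j) (v (k - 1) j) (v (k + 1) j) => x y w.
  have -> : (if (i == 0%N :> nat) && (N.-1 == j) then c N%:Z else 0) * y =
      (i == 0%N :> nat)%:R * ((N.-1 == j)%:R * (c N%:Z * y)).
    by case: (_ == _); case: (_ == _); rewrite /= ?(mul0r, mul1r, mulr0).
  have -> : (if (i.+1 == N) && (0%N == j) then a N%:Z else 0) * w =
      (i.+1 == N)%:R * ((0%N == j)%:R * (a N%:Z * w)).
    by case: (_ == _); case: (_ == _); rewrite /= ?(mul0r, mul1r, mulr0).
  rewrite addrA; congr (_ + _ + _).
  have [ij|_] := eqVneq (i : nat) j.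
    have -> : (i.+1 == j) = false by lia.
    have -> : (i == j.+1 :> nat) = false by lia.
    by rewrite !mul0r !addr0 mul1r.
  have [ij|_] := eqVneq i.+1 (j : nat).
    have -> : (i == j.+1 :> nat) = false by lia.
    by rewrite !mul0r addr0 add0r mul1r.
  by case: (_ == _); rewrite ?(mul0r, mul1r, addr0, add0r).
rewrite (eq_bigr _ (fun j _ => E j)) !big_split /= -!mulr_sumr.
rewrite (sum_ord_eq (fun p => b i.+1%:Z * v k p)) (sum_ord_eq (fun p => a i.+1%:Z * v k p)).
rewrite (sum_ord_eq (fun p => c i%:Z * v k p)) (sum_ord_eq (fun p => c N%:Z * v (k - 1) p)).
rewrite (sum_ord_eq (fun p => a N%:Z * v (k + 1) p)).
rewrite /jacobi !(periodic_int _ _ _ aN) !(periodic_int _ _ _ bN).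
have -> : k * N%:Z + (i%:Z + 1) - 1 = k * N%:Z + i%:Z by ring.
rewrite !(periodic_int _ _ _ cN) iN mul1r.
have i1 : i%:Z + 1 = i.+1%:Z by lia.
rewrite i1 N0 mul1r.
have Np : (N.-1 < N)%N by lia.
rewrite Np mul1r.
have -> : u (k * N%:Z + i.+1%:Z + 1) = v k i.+1 by congr u; lia.
have -> : u (k * N%:Z + i.+1%:Z) = v k i by congr u; lia.
have -> : c i%:Z * u (k * N%:Z + i%:Z) = (0 < i)%N%:R * ((i.-1 < N)%N%:R * (c i%:Z * v k i.-1)) +
   (i == 0%N :> nat)%:R * (c N%:Z * v (k - 1) N.-1).
  have [i0|i0] := posnP i.
    rewrite i0 mul0r add0r mul1r -(cN 0) add0r; congr (_ * u _).
    by rewrite mulrDl; lia.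
  rewrite (_ : (i.-1 < N)%N = true) ?mul1r ?mul0r ?addr0; last by lia.
  by congr (_ * u _); lia.
have {1}-> : a i.+1%:Z * v k i.+1 = (i.+1 < N)%N%:R * (a i.+1%:Z * v k i.+1) +
   (i.+1 == N)%:R * (a N%:Z * v (k + 1) 0%N).
  have [iN'|iN'] := eqVneq i.+1 N.
    rewrite iN' ltnn mul0r add0r mul1r; congr (_ * u _).
    by rewrite mulrDl; lia.
  by rewrite (_ : (i.+1 < N)%N = true) ?mul1r ?mul0r ?addr0 //; lia.
by ring.
Qed.

End Jacobi.
End Floquet.

(** * The unit circle, the Floquet determinant and its adjugate *)

Lemma expi_neq0 (R : realType) (t : R) : expi t != 0.
Proof.
apply/eqP => /(congr1 (@Normc.normc R)); rewrite Normc.normc0 /= cos2Dsin2 sqrtr1.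
exact/eqP/oner_neq0.
Qed.

Lemma normc_expi (R : realType) (t : R) : Normc.normc (expi t) = 1.
Proof. by rewrite /= cos2Dsin2 sqrtr1. Qed.

Lemma expiN (R : realType) (t : R) : expi (- t) = (expi t)^-1.
Proof. by rewrite -(conjc_unit _ _ (normc_expi _ t)) /expi cosN sinN. Qed.

Lemma expi_surj (R : realType) (w : R[i]) : Normc.normc w = 1 -> exists t, w = expi t.
Proof.
case: w => x y /= w1; have xy : x ^+ 2 + y ^+ 2 = 1.
  by rewrite -[LHS]sqr_sqrtr ?addr_ge0 ?sqr_ge0 // w1 expr1n.
have x1 : -1 <= x <= 1.
  by rewrite -ler_norml -(@expr_le1 _ 2) // real_normK ?num_real // -xy lerDl sqr_ge0.
have sx : Num.sqrt (1 - x ^+ 2) = `|y| by rewrite -xy addrAC subrr add0r sqrtr_sqr.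
have [y0|y0] := leP 0 y.
  by exists (acos x); rewrite /expi acosK ?in_itv //= sin_acos // sx ger0_norm.
exists (- acos x); rewrite /expi cosN sinN acosK ?in_itv //= sin_acos // sx.
by rewrite ltr0_norm // opprK.
Qed.

Section FloquetDeterminant.
Variables (R : realType) (N : nat) (N0 : (0 < N)%N) (a b c : int -> R[i]) (z : R[i]).

(* Rows of s (z - J(s)) as polynomials in s = exp(i t), which acts on sequences as
   the backward shift by N. *)
Definition floquet_poly : 'M[{poly R[i]}]_N :=
  \matrix_(i, j) ((z *+ (i == j) - jacobi0 N a b c i j) *: 'X^1 -
                  jacobi1 N c i j *: 'X^2 - jacobiN1 N a i j *: 'X^0).

Lemma det_floquet_poly (t : R) :
  (\det floquet_poly).[expi t] = expi t ^+ N * \det (z%:M - floquet N a b c t).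
Proof.
rewrite -detZ -[LHS]/(horner_eval (expi t) _) -det_map_mx; congr (\det _).
apply/matrixP => i j; rewrite !mxE /= /horner_eval expiN.
rewrite !(hornerD, hornerN, hornerZ, hornerXn) expr1 expr0.
by field; exact: expi_neq0.
Qed.

Lemma root_det_floquet_poly (t : R) :
  root (\det floquet_poly) (expi t) =
  ((discriminant N a b c).[z] ==
     period_prod N a * (expi t)^-1 + period_prod N c * expi t).
Proof.
rewrite /root det_floquet_poly mulf_eq0 expf_eq0 (negPf (expi_neq0 _ t)) andbF /=.
by rewrite discriminantE // expiN -addrA -opprD subr_eq0.
Qed.

Hypotheses (aN : periodic a N%:Z) (bN : periodic b N%:Z) (cN : periodic c N%:Z).

Let L (u : int -> R[i]) : int -> R[i] := fun n => z * u n - jacobi a b c u n.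

(** The extra factor ['X] in [floquet_poly] shifts back by one cell, hence the [k - 1]. *)
Lemma block_act_floquet_poly u i k :
  block_act _ _ floquet_poly (blocks _ _ u) i (k * N%:Z) =
  L u ((k - 1) * N%:Z + (i%:Z + 1)).
Proof.
rewrite /L (jacobi_blocks _ _ N0 _ _ _ aN bN cN).
have -> : z * u ((k - 1) * N%:Z + (i%:Z + 1)) =
    \sum_j z *+ (i == j) * blocks R N u j ((k - 1) * N%:Z).
  rewrite (bigD1 i) //= eqxx mulr1n big1 ?addr0 // => j.
  by rewrite eq_sym => /negPf ->; rewrite mulr0n mul0r.
rewrite -sumrB; apply: eq_bigr => j _; rewrite mxE.
rewrite !poly_shiftD -!scaleNr !poly_shiftZ !poly_shiftXn.
have -> : k * N%:Z - 1%:Z * N%:Z = (k - 1) * N%:Z by ring.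
have -> : k * N%:Z - 2%:Z * N%:Z = (k - 1 - 1) * N%:Z by ring.
have -> : k * N%:Z - 0%:Z * N%:Z = (k - 1 + 1) * N%:Z by ring.
by ring.
Qed.

Let Q := block_op R N N0 (\adj floquet_poly).

(** The adjugate times the matrix is its determinant; [n + N] compensates for the extra factor
    ['X]. *)
Lemma jacobi_adjugate_left h n :
  Q (L h) n = poly_shift N (\det floquet_poly) h (n + N%:Z).
Proof.
rewrite /Q /block_op /unblocks; set i := site _ _ n.
have nE : n - (i%:Z + 1) = cell N n * N%:Z by rewrite {1}(site_cellE _ N0 n) addrK.
rewrite nE.
(* The action of the matrix moved ahead by one cell, which agrees with the blocks of [L h] at
   multiples of [N]. *)
pose U j m := block_act _ _ floquet_poly (blocks _ _ h) j (m + N%:Z).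
rewrite (eq_block_act _ _ _ _ U) => [|j l]; last first.
  rewrite /U (_ : _ + _ = (l + 1) * N%:Z); last by ring.
  by rewrite block_act_floquet_poly addrK.
have -> : block_act _ _ (\adj floquet_poly) U i (cell N n * N%:Z) =
    block_act _ _ (\adj floquet_poly) (block_act _ _ floquet_poly (blocks _ _ h)) i
      (cell N n * N%:Z + N%:Z).
  by apply: eq_bigr => j _; rewrite poly_shift_translate.
rewrite block_actM mul_adj_mx block_act_scalar /blocks poly_shift_translate.
by congr poly_shift; rewrite -nE; ring.
Qed.

Lemma jacobi_adjugate_right h n :
  L (Q h) n = poly_shift N (\det floquet_poly) h (n + N%:Z).
Proof.
set i := site _ N0 n; have nE := site_cellE _ N0 n; rewrite -/i in nE.
have -> : L (Q h) n = block_act _ _ floquet_poly (blocks _ _ (Q h)) i ((cell N n + 1) * N%:Z).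
  by rewrite block_act_floquet_poly addrK -nE.
rewrite (eq_block_act _ _ _ _ (block_act _ _ (\adj floquet_poly) (blocks _ _ h))) => [|j l].
  rewrite block_actM mul_mx_adj block_act_scalar /blocks poly_shift_translate.
  by congr poly_shift; rewrite [in RHS]nE; ring.
by rewrite blocksK.
Qed.

(** If the determinant maps [h] to [f] shifted by [- N], then [Q h] solves [L u = f] by the right
    identity; the left identity gives injectivity. *)
Lemma jacobi_l2_invertible : \det floquet_poly != 0 ->
  (forall w, Normc.normc w = 1 -> ~~ root (\det floquet_poly) w) ->
  l2_invertible L.
Proof.
move=> D0 Dw; have [|[K K0 DK] Di] := @poly_shift_invertible R N (\det floquet_poly) D0.
  by move=> w rw; apply: contraTneq rw => w1; exact: Dw.
have [K' K'0 QK] := block_op_bounded R N N0 (\adj floquet_poly).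
split=> [|u ul2 u0].
  exists (K' * K); first exact: mulr_ge0.
  move=> f C /(sqsum_le_shift _ _ (- N%:Z))/DK[h hC hE]; exists (Q h).
    by rewrite -mulrA; exact: QK.
  by apply/funext => n; rewrite jacobi_adjugate_right hE addrK.
apply: Di => //; apply/funext => n.
rewrite -[n](subrK N%:Z) -jacobi_adjugate_left u0 /Q /block_op /unblocks.
by rewrite /block_act big1 // => j _; apply: big1 => l _; rewrite mulr0.
Qed.

End FloquetDeterminant.

(** * The spectrum *)

Section Resolvent.
Variable R : realType.
Implicit Types (u v f : int -> R[i]) (T : (int -> R[i]) -> int -> R[i]).

Lemma l2_linear_comb (k : R[i]) u v : l2 u -> l2 v -> l2 (fun n => k * u n + v n).
Proof.
move=> /l2_sqsum_le/(sqsum_leZ _ _ k) uC /l2_sqsum_le vC.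
exact: sqsum_le_l2 (sqsum_leD _ _ _ _ _ _ ltr01 uC vC).
Qed.

Lemma l2_invertible_resolvent T (z : R[i]) : l2_bounded T ->
  (forall k u v, T (fun n => k * u n + v n) = (fun n => k * T u n + T v n)) ->
  l2_invertible (fun u n => z * u n - T u n) -> resolvent_set T z.
Proof.
move=> Tb Tlin [[K K0 LK] Li]; pose L u : int -> R[i] := fun n => z * u n - T u n.
have Llin k u v : L (fun n => k * u n + v n) = (fun n => k * L u n + L v n).
  by apply/funext => n; rewrite /L Tlin; ring.
have L_inj u v : l2 u -> l2 v -> L u = L v -> u = v.
  move=> ul2 vl2 uv; have := Li _ (l2_linear_comb (-1) _ _ vl2 ul2).
  rewrite -/(L _) Llin uv => H; apply/funext => n.
  have /H/(congr1 (fun w => w n)) : (fun m => -1 * L v m + L v m) = (fun=> 0).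
    by apply/funext => m; rewrite mulN1r addNr.
  by rewrite mulN1r addrC => /subr0_eq.
have Ll2 u : l2 u -> l2 (L u).
  move=> ul2; have Tul2 := l2_bounded_l2 _ _ _ Tb ul2.
  have -> : L u = (fun n => -1 * T u n + z * u n).
    by apply/funext => n; rewrite /L mulN1r addrC.
  apply: l2_linear_comb => //.
  by have := sqsum_leZ _ _ z _ (l2_sqsum_le _ _ ul2); exact: sqsum_le_l2.
(* Preimages are chosen one by one; [L_inj] then makes the choice linear on [l2]. Off [l2] the zero
   sequence is a default. *)
have /choice[S SP] f : exists u, l2 f ->
    [/\ l2 u, L u = f & l2norm u ^+ 2 <= K * l2norm f ^+ 2].
  have [fl2|] := pselect (l2 f); last by exists (fun=> 0).
  have [u uC uf] := LK _ _ (l2_sqsum_le _ _ fl2); exists u => _; split => //.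
    exact: (sqsum_le_l2 _ _ _ uC).
  exact: (l2norm_sqr_le _ _ _ uC).
exists S; split; last first.
  move=> u ul2; split; last by have [_] := SP u ul2.
  by have [Sl2 LS _] := SP _ (Ll2 _ ul2); exact: L_inj.
split.
- by move=> u /SP[].
- move=> k u v ul2 vl2; have [Sul2 LSu _] := SP u ul2; have [Svl2 LSv _] := SP v vl2.
  have [Sl2 LS _] := SP _ (l2_linear_comb k _ _ ul2 vl2).
  by apply: L_inj => //; [exact: l2_linear_comb | rewrite LS Llin LSu LSv].
- exists (Num.sqrt K) => u /SP[_ _ Su].
  rewrite -ler_sqr ?nnegrE ?mulr_ge0 ?sqrtr_ge0 //.
  by rewrite exprMn (sqr_sqrtr K0).
Qed.

Lemma sqsum_le_support u (t : seq int) (G : R) : (forall n, Normc.normc (u n) <= G) ->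
  (forall n, n \notin t -> u n = 0) -> sqsum_le u ((size t)%:R * G ^+ 2).
Proof.
move=> uG ut s us; have G0 : 0 <= G := le_trans (normc_ge0 _ (u 0)) (uG 0).
rewrite (bigID (mem t)) /= [X in _ + X]big1 ?addr0; last first.
  by move=> n /ut ->; rewrite Normc.normc0 expr0n.
rewrite -big_filter; set s' := [seq _ <- _ | _].
have s't : (size s' <= size t)%N.
  by apply: uniq_leq_size; [exact: filter_uniq | move=> n; rewrite mem_filter => /andP[]].
apply: (@le_trans _ _ (\sum_(n <- s') G ^+ 2)).
  by apply: ler_sum => n _; rewrite ler_sqr ?nnegrE ?normc_ge0.
by rewrite big_const_seq count_predT iter_addr_0 -[leLHS]mulr_natl ler_wpM2r ?sqr_ge0 // ler_nat.
Qed.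

End Resolvent.

Section JacobiSpectrum.
Variables (R : realType) (N : nat) (N0 : (0 < N)%N) (a b c : int -> R[i]).
Hypotheses (aN : periodic a N%:Z) (bN : periodic b N%:Z) (cN : periodic c N%:Z).

Lemma periodic_bounded (f : int -> R[i]) : periodic f N%:Z ->
  exists K, forall n, Normc.normc (f n) <= K.
Proof.
move=> fN; exists (\sum_(i < N) Normc.normc (f (i%:Z + 1))) => n.
rewrite (site_cellE _ N0 n) (periodic_int _ _ _ _ _ fN).
by rewrite (bigD1 (site _ N0 n)) //= lerDl; apply: sumr_ge0 => i _; exact: normc_ge0.
Qed.

Lemma jacobi_linear (k : R[i]) (u v : int -> R[i]) :
  jacobi a b c (fun n => k * u n + v n) =
  (fun n => k * jacobi a b c u n + jacobi a b c v n).
Proof. by apply/funext => n; rewrite /jacobi; ring. Qed.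

Lemma jacobi_bounded : l2_bounded (jacobi a b c).
Proof.
have [A aA] := periodic_bounded _ aN; have [B bB] := periodic_bounded _ bN.
have [C cC] := periodic_bounded _ cN.
apply: (l2_boundedD _ (fun u n => a n * u (n + 1) + b n * u n)
                      (fun u n => c (n - 1) * u (n - 1))).
  apply: (l2_boundedD _ (fun u n => a n * u (n + 1)) (fun u n => b n * u n)).
    exact: l2_bounded_mul aA (l2_bounded_shift _ 1).
  exact: l2_bounded_mul bB (l2_bounded_id _).
apply: (l2_bounded_mul _ (fun n => c (n - 1)) (fun u n => u (n - 1)) C) => //.
exact: l2_bounded_shift.
Qed.

(** A kernel vector of [z - J(t)] is continued from cell to cell by a constant multiplier; the
    exponent is [- cell] because [expi t] stands for the backward shift. *)
Lemma floquet_solution (z : R[i]) (t : R) : \det (z%:M - floquet N a b c t) = 0 ->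
  exists2 v : 'rV[R[i]]_N, v != 0 &
    forall n, z * (expi t ^ (- cell N n) * v 0 (site _ N0 n)) -
      jacobi a b c (fun n => expi t ^ (- cell N n) * v 0 (site _ N0 n)) n = 0.
Proof.
rewrite -det_tr => /eqP/det0P[v v0 vM]; exists v => // n.
set s := expi t; pose u n := s ^ (- cell N n) * v 0 (site _ N0 n).
have s0 : s != 0 := expi_neq0 _ t.
have uE k (j : 'I_N) : blocks _ _ u j (k * N%:Z) = s ^ (- k) * v 0 j.
  rewrite /blocks /u siteE; congr (s ^ (- _) * _); have jN := ltn_ord j.
  by rewrite /cell addrA addrK divzMDl ?divz_small ?addr0 //; lia.
have vM' (i : 'I_N) : \sum_j (z *+ (i == j) - (jacobi0 N a b c i j +
     s * jacobi1 N c i j + s^-1 * jacobiN1 N a i j)) * v 0 j = 0.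
  have := congr1 (fun w : 'rV[R[i]]_N => w 0 i) vM; rewrite !mxE => {2}<-.
  by apply: eq_bigr => j _; rewrite !mxE expiN mulrC.
rewrite -/(u n) (site_cellE _ N0 n); move: (cell N n) (site _ N0 n) => k i.
rewrite (jacobi_blocks _ _ N0 _ _ _ aN bN cN).
have -> : z * u (k * N%:Z + (i%:Z + 1)) =
   \sum_j z *+ (i == j) * blocks _ _ u j (k * N%:Z).
  rewrite (bigD1 i) //= eqxx mulr1n big1 ?addr0 // => j.
  by rewrite eq_sym => /negPf ->; rewrite mulr0n mul0r.
transitivity (s ^ (- k) * \sum_j (z *+ (i == j) - (jacobi0 N a b c i j +
     s * jacobi1 N c i j + s^-1 * jacobiN1 N a i j)) * v 0 j); last by rewrite vM' mulr0.
rewrite -sumrB -/u mulr_sumr; apply: eq_bigr => j _.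
have -> : blocks _ _ u j ((k - 1) * N%:Z) = s ^ (- k) * s * v 0 j.
  by rewrite uE opprB addrC expfzDr // expr1z.
have -> : blocks _ _ u j ((k + 1) * N%:Z) = s ^ (- k) * s^-1 * v 0 j.
  by rewrite uE opprD expfzDr // exprN1.
by rewrite uE; ring.
Qed.

Lemma spectrum_jacobi :
  spectrum (jacobi a b c) =
  [set z | exists2 w, Normc.normc w = 1 &
     (discriminant N a b c).[z] = period_prod N a * w^-1 + period_prod N c * w]%classic.
Proof.
apply/seteqP; split=> z /=.
- apply: contra_notP => zw.
  apply: (l2_invertible_resolvent _ _ z jacobi_bounded jacobi_linear).
  have D1 w : Normc.normc w = 1 -> ~~ root (\det (floquet_poly _ N a b c z)) w.
    move=> w1; apply/negP; have [t wt] := expi_surj _ _ w1.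
    rewrite wt root_det_floquet_poly // -wt => /eqP Pw.
    by apply: zw; exists w.
  apply: (jacobi_l2_invertible _ _ N0 _ _ _ _ aN bN cN) => //.
  by apply: contraNneq (D1 1 (Normc.normc1 _)) => ->; rewrite root0.
move=> [w w1]; have [t wt] := expi_surj _ _ w1; rewrite wt => /eqP.
rewrite -root_det_floquet_poly // /root det_floquet_poly mulf_eq0 expf_eq0.
rewrite (negPf (expi_neq0 _ t)) andbF /= => /eqP /floquet_solution[v v0 vE].
set s := expi t in vE; pose u n := s ^ (- cell N n) * v 0 (site _ N0 n).
have un n : Normc.normc (u n) = Normc.normc (v 0 (site _ N0 n)).
  rewrite Normc.normcM (_ : Normc.normc (s ^ _) = 1) ?mul1r //.
  have sX p : Normc.normc (s ^+ p) = 1 by rewrite normcX normc_expi expr1n.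
  by case: (- _) => p; rewrite /exprz /= ?Normc.normcV sX ?invr1.
have [i vi] : exists i, v 0 i != 0.
  by apply/existsP; rewrite -negb_forall; apply: contra v0 => /forallP v0;
     apply/eqP/rowP => i; rewrite mxE; apply/eqP.
pose B := \sum_i Normc.normc (v 0 i).
have uB n : Normc.normc (u n) <= B.
  rewrite un /B (bigD1 (site _ N0 n)) //= lerDl.
  by apply: sumr_ge0 => j _; exact: normc_ge0.
have [A aA] := periodic_bounded _ aN; have [Bb bB] := periodic_bounded _ bN.
have [C cC] := periodic_bounded _ cN.
move=> [S [[Sl2 _ [M SM]] Sz]].
pose G := Normc.normc z * B + (A * B + Bb * B + C * B).
(* Truncation of the Floquet solution to the indices from 0 to [m N]. The defect [g m] is bounded by
   [G] and supported on the four sites [T m] at the cuts, uniformly in [m]. *)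
pose U m n := if (0 <= n) && (n <= (m * N)%N%:Z) then u n else 0.
have UB m n : Normc.normc (U m n) <= B.
  rewrite /U; case: ifP => _ //; rewrite Normc.normc0.
  exact: le_trans (normc_ge0 _ (u 0)) (uB 0).
pose g m n := z * U m n - jacobi a b c (U m) n.
have gG m n : Normc.normc (g m n) <= G.
  have prod x y X Y : Normc.normc x <= X -> Normc.normc y <= Y ->
      Normc.normc (x * y) <= X * Y :> R.
    by move=> xX yY; rewrite Normc.normcM ler_pM // normc_ge0.
  rewrite (le_trans (le_normcD _ _)) // normcN lerD ?prod // /jacobi.
  rewrite (le_trans (le_normcD _ _)) // lerD ?prod //.
  by rewrite (le_trans (le_normcD _ _)) // lerD ?prod.
pose T m : seq int := [:: -1; 0; (m * N)%N%:Z; (m * N)%N%:Z + 1].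
have gT m n : n \notin T m -> g m n = 0.
  rewrite !inE => nT; rewrite /g /jacobi /U.
  have [nm|nm] : (1 <= n < (m * N)%N%:Z) \/ (n < -1) || ((m * N)%N%:Z + 1 < n) by lia.
    rewrite !ifT; try lia.
    exact: vE.
  by rewrite !ifF ?mulr0 ?addr0 ?subrr //; lia.
have Ul2 m : l2 (U m).
  apply: sqsum_le_l2 (sqsum_le_support _ _ [seq k%:Z | k <- iota 0 (m * N).+1] B (UB m) _).
  move=> n; rewrite /U; case: ifP => // /andP[n0 nm] /mapP[]; exists (absz n).
    by rewrite mem_iota; lia.
  by lia.
have gC m := sqsum_le_support _ _ (T m) G (gG m) (gT m).
(* A bounded inverse [S] would bound the norm of [U m = S (g m)] independently of [m], yet its
   square is at least [m] times |v_i|^2. *)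
have Um m : m%:R * Normc.normc (v 0 i) ^+ 2 <= M ^+ 2 * (4 * G ^+ 2).
  have gl2 := sqsum_le_l2 _ _ _ (gC m).
  have SgE : S (g m) = U m by have [] := Sz _ (Ul2 m).
  have := SM _ gl2; rewrite SgE => UM.
  have gle := l2norm_sqr_le _ _ _ (gC m).
  apply: (@le_trans _ _ (l2norm (U m) ^+ 2)); last first.
    apply: (@le_trans _ _ ((M * l2norm (g m)) ^+ 2)).
      rewrite ler_sqr ?nnegrE ?(le_trans _ UM) //; exact: sqrtr_ge0.
    by rewrite exprMn ler_wpM2l // sqr_ge0.
  (* One site in each of the cells 0 to [m - 1], all within the truncation, where [u] has modulus
     |v_i|. *)
  pose ks := [seq k%:Z * N%:Z + (i%:Z + 1) | k <- iota 0 m].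
  have := l2_sqsum_le _ _ (Ul2 m) ks; rewrite /ks big_map => /(_ _).
  have ut : uniq ks.
    rewrite map_inj_uniq ?iota_uniq // => k l /addIr kl.
    by have /mulIf/(_ _ _ kl)[] : N%:Z != 0 by lia.
  move=> /(_ ut); rewrite (eq_big_seq (fun=> Normc.normc (v 0 i) ^+ 2)) => [|k].
    by rewrite big_const_seq count_predT size_iota iter_addr_0 -[leLHS]mulr_natl.
  rewrite mem_iota add0n /U => /andP[_ km].
  rewrite ifT ?un ?siteE //; have := ltn_ord i => iN; nia.
have vi0 : 0 < Normc.normc (v 0 i) ^+ 2 by rewrite exprn_gt0 // normc_gt0.
have /archi_boundP : 0 <= M ^+ 2 * (4 * G ^+ 2) / Normc.normc (v 0 i) ^+ 2.
  exact: divr_ge0 (mulr_ge0 (sqr_ge0 M) (mulr_ge0 (ler0n _ 4) (sqr_ge0 G))) (ltW vi0).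
by rewrite ltr_pdivrMr // ltNge Um.
Qed.

End JacobiSpectrum.

(** * The theorem *)

Lemma discriminant_monic (R : realType) (N : nat) (a b c : int -> R[i]) :
  (0 < N)%N -> discriminant N a b c \is monic /\ size (discriminant N a b c) = N.+1.
Proof.
move=> N0; have sz : (size (period_prod N a + period_prod N c)%:P <
    size (char_poly (floquet N a b c 0)))%N.
  by rewrite size_char_poly (leq_ltn_trans (size_polyC_leq1 _)).
split; last by rewrite /discriminant size_polyDl // size_char_poly.
by rewrite monicE /discriminant lead_coefDl // -monicE char_poly_monic.
Qed.

Lemma card_eq_uniq_seq (T : choiceType) (A : set T) (s : seq T) :
  uniq s -> (forall x, x \in s <-> A x) -> (A #= `I_(size s))%card.
Proof.
move=> us sA; have Afin : finite_set A.
  by apply: sub_finite_set (finite_seq s) => x /sA.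
rewrite -[A]fset_setK //; apply/card_eq_fsetP/perm_size/uniq_perm => //.
by move=> x; rewrite in_fset_set //; apply/idP/idP; rewrite inE => /sA.
Qed.

Lemma card_eq_seq (T : choiceType) (A : set T) n : (A #= `I_n)%card ->
  exists s : seq T, [/\ uniq s, size s = n & forall x, x \in s <-> A x].
Proof.
move=> An; have Afin : finite_set A by apply/finite_setP; exists n.
exists (finmap.enum_fset (fset_set A)); split.
- exact: finmap.fset_uniq.
- exact: card_fset_set.
- by move=> x; rewrite in_fset_set // inE.
Qed.

Local Open Scope classical_set_scope.

Theorem theorem1p4 (R : realType) (N : nat) (a b c : int -> R[i])
    (alpha beta : R) :
  (0 < N)%N ->
  periodic a N%:Z -> periodic b N%:Z -> periodic c N%:Z ->
  ~ (period_prod N a = 0 /\ period_prod N c = 0) ->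
  alpha < beta ->
  let P := discriminant N a b c in
  let S := stationary_points P in
  let r := Normc.normc (period_prod N a) in
  spectrum (jacobi a b c) = [set x%:C | x in `[alpha, beta]] <->
  [/\ period_prod N a = conjc (period_prod N c),
      (S #= `I_(N.-1))%card /\
      [set P.[z] | z in S] `<=` [set (2 * r)%:C; (- (2 * r))%:C]
    & [set P.[z] | z in [set alpha%:C; beta%:C]] `<=`
        [set (2 * r)%:C; (- (2 * r))%:C] /\
      ~ S alpha%:C /\ ~ S beta%:C].
Proof.
move=> N0 aN bN cN ac0 ab P S r; rewrite (spectrum_jacobi _ _ N0 _ _ _ aN bN cN) -/P.
have [Pm szP] := discriminant_monic _ _ a b c N0; rewrite -/P in Pm szP.
have P1 : (1 < size P)%N by rewrite szP.
have a0 : period_prod N a = conjc (period_prod N c) -> period_prod N a != 0.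
  move=> E; apply/eqP => A0; apply: ac0; split => //; apply/eqP.
  by rewrite -conjc_eq0 -E A0.
have segP z : [set x%:C | x in `[alpha, beta]] z <->
    exists2 x, alpha <= x <= beta & z = x%:C.
  by split=> [[x /=]|[x xab ->]]; [rewrite in_itv /= => xab <-|]; exists x; rewrite //= in_itv.
split=> [spec|[aE [Scard SP] [endP [Sa Sb]]]].
- have H z : (exists2 w, Normc.normc w = 1 &
        P.[z] = period_prod N a * w^-1 + period_prod N c * w) <->
      exists2 x, alpha <= x <= beta & z = x%:C.
    by rewrite -segP -spec.
  have aE : period_prod N a = conjc (period_prod N c).
    apply: ellipse_preimage_real Pm P1 ab _ => x xab.
    by apply/H; exists x.
  have rho0 : 0 < 2 * r by rewrite mulr_gt0 // normc_gt0 // a0.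
  (* The ellipse has collapsed to [-2r, 2r], so the results on real preimages apply with
     [rho = 2 r]. *)
  have pre z : (- (2 * r))%:C <= P.[z] <= (2 * r)%:C <->
      exists2 x, alpha <= x <= beta & z = x%:C.
    by rewrite -H (degenerate_ellipse _ _ _ _ aE (a0 aE)).
  have [s [us szs sE]] := stationary_preimage_seq _ _ _ _ _ Pm P1 rho0 pre.
  have aend : (P.[alpha%:C] = (2 * r)%:C \/ P.[alpha%:C] = (- (2 * r))%:C) /\
      P^`().[alpha%:C] != 0.
    (* The directions -1 at [alpha] and 1 at [beta] leave the segment. *)
    apply: (preimage_endpoint _ _ _ _ _ Pm P1 rho0 pre _ (-1)) => [||h h0].
    - by rewrite lexx ltW.
    - by rewrite oppr_eq0 oner_eq0.
    - by rewrite mulrN1 negb_and -ltNge; apply/orP; left; lra.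
  have bend : (P.[beta%:C] = (2 * r)%:C \/ P.[beta%:C] = (- (2 * r))%:C) /\
      P^`().[beta%:C] != 0.
    apply: (preimage_endpoint _ _ _ _ _ Pm P1 rho0 pre _ 1) => [||h h0].
    - by rewrite lexx ltW.
    - exact: oner_neq0.
    - by rewrite mulr1 negb_and -!ltNge; apply/orP; right; lra.
  split=> //; split.
  + have -> : N.-1 = size s by rewrite szs szP.
    by apply: card_eq_uniq_seq => // z; rewrite sE; split=> /eqP.
  + move=> _ [z Sz <-] /=.
    by have [_ [[-> _]|[-> _]]] := critical_preimage _ _ _ _ _ Pm P1 rho0 pre z Sz; [left|right].
  + by move=> _ [z [->|->] <-]; [exact: aend.1 | exact: bend.1].
  + by split; apply/eqP; [exact: aend.2 | exact: bend.2].
have [s [us szs sE]] := card_eq_seq _ _ _ Scard.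
have rho0 : 0 < 2 * r by rewrite mulr_gt0 // normc_gt0 // a0.
have sP z : (z \in s) = root P^`() z.
  by apply/idP/idP => [/sE/eqP|/eqP/sE].
have pre : forall z, (- (2 * r))%:C <= P.[z] <= (2 * r)%:C <->
    exists2 x, alpha <= x <= beta & z = x%:C.
  apply: (joukowski_preimage _ _ _ _ _ s rho0 Pm P1 ab us _ sP).
  - by rewrite szs szP.
  - move=> z; rewrite !inE => /orP[/eqP->|/orP[/eqP->|/sE Sz]].
    + by apply: endP; exists alpha%:C => //; left.
    + by apply: endP; exists beta%:C => //; right.
    + by apply: SP; exists z.
  - by apply/negP => /sE.
  - by apply/negP => /sE.
apply/seteqP; split=> z; rewrite segP -pre -(degenerate_ellipse _ _ _ _ aE (a0 aE)) //.
Qed.
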